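(* Let $n\ge2$, $I=[n]$ and let $W$ be the Weyl group of type $C_n$. Let $i\in I$, $w\in W^{I\setminus\{i\}}$ and $\gamma\in\Delta^+$. There exists a quantum edge $w\xrightarrow{\gamma}\lfloor wr_\gamma\rfloor$ in the quantum Bruhat graph $\mathrm{QB}^{I\setminus\{i\}}$ if and only if $\gamma\in\Delta^+\setminus\Delta^+_{I\setminus\{i\}}$ and the following holds: $c_i(\gamma^\vee)=1$, $\lfloor wr_\gamma\rfloor(1)=1$, $\lfloor wr_\gamma\rfloor(u)=w(u-1)$ for $u\in\{2,\dots,i\}$, and $w(i)=\overline1$. In this case, $\gamma^\vee=\varepsilon_i=\alpha_i^\vee+\alpha_{i+1}^\vee+\cdots+\alpha_n^\vee$.
   Context: Let $\varepsilon_1,\dots,\varepsilon_n$ be an orthonormal basis of $\mathbb{R}^n$, $\Delta=\{\pm(\varepsilon_s\pm\varepsilon_t)\mid s<t\}\sqcup\{\pm2\varepsilon_s\}$ (type $C_n$), simple roots $\alpha_s=\varepsilon_s-\varepsilon_{s+1}$ ($s\le n-1$), $\alpha_n=2\varepsilon_n$; the coroot is $\gamma^\vee=2\gamma/(\gamma,\gamma)$, and $c_i(\xi)$ is the coefficient of $\alpha_i^\vee$ in $\xi\in\bigoplus_i\mathbb{Z}\alpha_i^\vee$. Let $\mathcal C_n=\{1\prec\cdots\prec n\prec\overline n\prec\cdots\prec\overline1\}$, $\sigma:s\leftrightarrow\overline s$. Identifying $s=\varepsilon_s$, $\overline s=-\varepsilon_s$, $W=\{w\in\mathfrak S(\mathcal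 C_n)\mid w\sigma=\sigma w\}$. For $J\subset I$: $W_J=\langle r_j\mid j\in J\rangle$, $W^J$ is the set of minimal-length representatives of $W/W_J$, $\lfloor w\rfloor\in W^J$ the minimal representative of $wW_J$, $\Delta_J^+=\Delta^+\cap\bigoplus_{j\in J}\mathbb{Z}\alpha_j$, $\rho=\frac12\sum_{\alpha\in\Delta^+}\alpha$, $\rho_J=\frac12\sum_{\alpha\in\Delta_J^+}\alpha$. The (parabolic) quantum Bruhat graph $\mathrm{QB}^J$ has vertex set $W^J$ and edges $w\xrightarrow{\gamma}\lfloor wr_\gamma\rfloor$ for $w\in W^J$, $\gamma\in\Delta^+\setminus\Delta_J^+$ with $\ell(\lfloor wr_\gamma\rfloor)-\ell(w)=1-2\chi\langle\gamma^\vee,\rho-\rho_J\rangle$ for some $\chi\in\{0,1\}$; the edge is Bruhat if $\ell(\lfloor wr_\gamma\rfloor)-\ell(w)=1$ and quantum if $\ell(\lfloor wr_\gamma\rfloor)-\ell(w)=1-2\langle\gamma^\vee,\rho-\rho_J\rangle$. *)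

(* Defs.v *)
From HB Require Import structures.
From mathcomp Require Import all_boot all_order all_fingroup all_algebra.
From mathcomp Require Import reals.

Set Implicit Arguments.
Unset Strict Implicit.
Unset Printing Implicit Defensive.

Import Order.TTheory GRing.Theory Num.Theory.
Local Open Scope ring_scope.

(** Indices are 0-based: the paper's [s \in {1, ..., n}] is [s.-1 : 'I_n].
    The letter [s] of C_n is [(s, false)] and its partner [\bar s] is
    [(s, true)]. *)
Notation letter n := ('I_n * bool)%type.

Definition pos n (s : 'I_n) : letter n := (s, false).
Definition bar n (s : 'I_n) : letter n := (s, true).

Definition flip n (a : letter n) : letter n := (a.1, ~~ a.2).

Lemma flipK n : involutive (@flip n).
Proof. by case=> s b; rewrite /flip /= negbK. Qed.

Definition sigma n : {perm letter n} := perm (inv_inj (@flipK n)).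

Definition weyl n : {group {perm letter n}} := 'C[sigma n]%G.

(** MathComp permutations compose from left to right: [(x * w) a = w (x a)].
    [wmul w x] is the usual composite, w after x. *)
Definition wmul n (w x : {perm letter n}) : {perm letter n} := (x * w)%g.

Section TypeC.
Variables (R : realType) (n : nat).
Local Notation V := 'rV[R]_n.

Definition eps (s : 'I_n) : V := delta_mx 0 s.

Definition dot (u v : V) : R := \sum_k u 0 k * v 0 k.

Definition wt (a : letter n) : V := (-1) ^+ a.2 *: eps a.1.

Definition roots : seq V :=
  undup
    ([seq (-1) ^+ x.1.1 *: (eps x.2.1 + (-1) ^+ x.1.2 *: eps x.2.2)
       | x : (bool * bool) * ('I_n * 'I_n)
            in [pred x : (bool * bool) * ('I_n * 'I_n) | (x.2.1 < x.2.2)%N]]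
     ++ [seq (-1) ^+ x.1 *: (2 *: eps x.2) | x : bool * 'I_n]).

Definition coroot (g : V) : V := (2 / dot g g) *: g.

(** [insub s.+1] is [None] exactly when [s] is the last index. *)
Definition simple_root (s : 'I_n) : V :=
  if insub s.+1 is Some t then eps s - eps t else 2 *: eps s.

Definition simple_roots : n.-tuple V := [tuple simple_root j | j < n].
Definition simple_coroots : n.-tuple V := [tuple coroot (simple_root j) | j < n].

Definition coroot_coef (i : 'I_n) (xi : V) : R := coord simple_coroots i xi.

Definition pos_roots : seq V :=
  [seq g <- roots | [forall j, coord simple_roots j g \is a Num.nat]].

Definition in_root_lattice (J : {set 'I_n}) (g : V) : bool :=
  [forall j, if j \in J then coord simple_roots j g \is a Num.int
             else coord simple_roots j g == 0].

Definition pos_roots_of (J : {set 'I_n}) : seq V :=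
  [seq g <- pos_roots | in_root_lattice J g].

Definition rho : V := 2^-1 *: \sum_(g <- pos_roots) g.
Definition rho_of (J : {set 'I_n}) : V := 2^-1 *: \sum_(g <- pos_roots_of J) g.

Definition reflect_vec (g v : V) : V := v - dot v (coroot g) *: g.

(** The reflection r_g as an element of W; the default value 1 is only
    returned when g is not a multiple of a root. *)
Definition refl (g : V) : {perm letter n} :=
  odflt 1%g
    [pick w in weyl n | [forall a, wt (w a) == reflect_vec g (wt a)]].

Definition weyl_of (J : {set 'I_n}) : {set {perm letter n}} :=
  <<[set refl (simple_root j) | j in J]>>%g.

(** Coxeter length: the least k such that w is a product of k simple
    reflections.  The bound loses nothing: the successive prefixes of a
    shortest word are pairwise distinct elements of W. *)
Definition is_word_of_length (w : {perm letter n}) (k : nat) : bool :=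
  [exists t : k.-tuple 'I_n, w == (\prod_(j <- t) refl (simple_root j))%g].

Definition len (w : {perm letter n}) : nat :=
  find (is_word_of_length w) (iota 0 #|weyl n|).

Definition weyl_coset (J : {set 'I_n}) (w : {perm letter n}) :
    {set {perm letter n}} := [set wmul w x | x in weyl_of J].

Definition min_reps (J : {set 'I_n}) : {set {perm letter n}} :=
  [set w in weyl n | [forall v in weyl_coset J w, (len w <= len v)%N]].

Definition min_rep (J : {set 'I_n}) (w : {perm letter n}) : {perm letter n} :=
  [arg min_(v < w in weyl_coset J w) len v].

Definition QB_pairing (J : {set 'I_n}) (g : V) : R :=
  dot (coroot g) (rho - rho_of J).

Definition QB_edge (J : {set 'I_n}) (w : {perm letter n}) (g : V)
    (v : {perm letter n}) : Prop :=
  [/\ w \in min_reps J,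
      (g \in pos_roots) && (g \notin pos_roots_of J),
      v = min_rep J (wmul w (refl g)) &
      exists chi : bool,
        (len v)%:R - (len w)%:R = 1 - 2 * chi%:R * QB_pairing J g].

Definition quantum_edge (J : {set 'I_n}) (w : {perm letter n}) (g : V)
    (v : {perm letter n}) : Prop :=
  QB_edge J w g v /\ (len v)%:R - (len w)%:R = 1 - 2 * QB_pairing J g.

End TypeC.

(* Main.v *)
(* Twice the length of an element of W is the number of its inversions on the
   chain of letters plus the number of its negative values.  Summing these
   statistics over the minimal representative of a coset gives its length in
   terms of the set A of its first i values, as [sum_ht A - neg_pairs A / 2] up
   to a constant.  Replacing one letter of A by another lowers this by at most
   2n - i, and the maximal drop occurs exactly when bar 1 is replaced by 1.
   On the other side, 2 (rho - rho_J) = (2n + 1 - i) (eps_1 + ... + eps_i), so a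
   quantum edge must lower the length by 2n - i when the reflection replaces one
   letter of A, and by 4n - 2i + 1 when it replaces two (gamma = eps_s + eps_t
   with s < t <= i).  The latter is impossible, being two steps of drop at most
   2n - i each; in the former w(s) = bar 1 is sent to 1, hence gamma = 2 eps_s,
   and s = i because w increases on 1, ..., i. *)

Require Import Defs.
From HB Require Import structures.
From mathcomp Require Import all_boot all_order all_fingroup all_algebra.
From mathcomp Require Import reals.
From mathcomp Require Import zify lra.

Set Implicit Arguments.
Unset Strict Implicit.
Unset Printing Implicit Defensive.

Import Order.TTheory GRing.Theory Num.Theory.
Local Open Scope ring_scope.

(** * The chain of letters, and inversions under simple reflections *)

Section Letters.
Local Open Scope nat_scope.
Variable n : nat.
Implicit Types (a b c x y : letter n) (w : {perm letter n}) (s t j k : 'I_n).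

(* Rank of a letter in the chain 1 < ... < n < bar n < ... < bar 1, from 0. *)
Definition ht a : nat := if a.2 then (n.*2.-1 - a.1)%N else a.1.

Lemma ht_flip a : ht (flip a) = (n.*2.-1 - ht a)%N.
Proof. by case: a => s [] /=; rewrite /ht /=; have := ltn_ord s; lia. Qed.

Lemma ht_lt a : (ht a < n.*2)%N.
Proof. by case: a => s [] /=; rewrite /ht /=; have := ltn_ord s; lia. Qed.

Lemma ht_inj : injective ht.
Proof.
move=> [s b] [t c]; rewrite /ht /= => E.
have ls := ltn_ord s; have lt := ltn_ord t.
have bc : b = c by case: b E; case: c => // E; lia.
rewrite -bc in E *; congr (_, _); apply: val_inj => /=.
by case: (b) E; lia.
Qed.

Lemma flip_neq a : flip a != a.
Proof. by case: a => s []; rewrite xpair_eqE eqxx. Qed.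

Lemma ht_ltflip a : (ht (flip a) < ht a)%N = a.2.
Proof. by case: a => s []; rewrite /ht /=; have := ltn_ord s; lia. Qed.

Lemma ht_flip2 a b : (ht (flip a) < ht (flip b))%N = (ht b < ht a)%N.
Proof. by rewrite !ht_flip; have := ht_lt a; have := ht_lt b; lia. Qed.

Lemma ht_flipC a b : (ht (flip a) < ht b)%N = (ht (flip b) < ht a)%N.
Proof. by rewrite -{1}(flipK b) ht_flip2. Qed.

Lemma weylP w : reflect (forall a, w (flip a) = flip (w a)) (w \in weyl n).
Proof.
apply: (iffP cent1P) => [cw a | cw].
  by have := congr1 (fun x : {perm _} => x a) cw; rewrite !permM !permE /= => ->.
by apply/permP => a; rewrite !permM !permE /= cw.
Qed.

(** The element of W that swaps [pos s] and [c]. Commuting with [sigma] forces a second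
    transposition, of the flips; for [c = bar s] it coincides with the first, and the product would
    be trivial. *)
Definition rperm s c : {perm letter n} :=
  (if c == bar s then tperm (pos s) c
   else tperm (pos s) c * tperm (bar s) (flip c))%g.

(** [rperm s (next_letter s)] is the simple reflection of index [s]; at the last index the successor
    of [pos s] in the chain is its own flip. *)
Definition next_letter s : letter n :=
  if insub s.+1 is Some t then pos t else bar s.

Lemma ht_next s : ht (next_letter s) = s.+1.
Proof.
rewrite /next_letter; case: insubP => [t _ <- //|].
by rewrite -leqNgt /ht /=; have := ltn_ord s; lia.
Qed.

(** One formula serves both shapes of [rperm]: when [c = bar s], the last two tests are shadowed by
    the first two. *)
Lemma rpermE s c a : c != pos s ->
  rperm s c a = if a == pos s then c else if a == c then pos s else
                if a == bar s then flip c else if a == flip c then bar s else a.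
Proof.
move=> /eqP cs; have fc := elimN eqP (flip_neq c).
have ffc := flipK c; have fp : flip (pos s) = bar s by [].
have fb : flip (bar s) = pos s by [].
have pb : pos s <> bar s by [].
rewrite /rperm; case: (eqVneq c (bar s)) => [E | /eqP cb].
  by case: tpermP => [->|->|? ?]; do !case: eqP => //; congruence.
by rewrite permM; case: (tpermP (pos s) c a) => [->|->|? ?];
  case: tpermP => [?|?|? ?]; do !case: eqP => //; congruence.
Qed.

Lemma rperm_weyl s c : c != pos s -> rperm s c \in weyl n.
Proof.
move=> cs; apply/weylP => a; rewrite !rpermE //.
move/eqP: cs => cs; have fc := elimN eqP (flip_neq c).
have ffc := flipK c; have fp : flip (pos s) = bar s by [].
have ffa := flipK a; have fa := elimN eqP (flip_neq a).
have fb : flip (bar s) = pos s by [].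
have pb : pos s <> bar s by [].
by do !case: eqP => //; congruence.
Qed.

(* For [w] in W the inversions come in pairs [(a, b)], [(flip b, flip a)], except
   those with [b = flip a]; [negs] counts the latter once more, so that [dinv] is
   even. *)
Definition chain_inv w : nat :=
  \sum_(p : letter n * letter n)
     ((ht p.1 < ht p.2) && (ht (w p.2) < ht (w p.1)))%N.

Definition negs w : nat := \sum_s (w (pos s)).2.

Definition dinv w : nat := (chain_inv w + negs w)%N.

(** No letter lies between consecutive ones, so the swap alters the status of the pair [a], [b]
    only. *)
Lemma chain_inv_tperm w a b : ht b = (ht a).+1 ->
  (chain_inv (tperm a b * w)%g + (ht (w b) < ht (w a))
   = chain_inv w + (ht (w a) < ht (w b)))%N.
Proof.
move=> hab; pose tt (p : letter n * letter n) := (tperm a b p.1, tperm a b p.2).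
have ttK : involutive tt by case=> x y; rewrite /tt /= !tpermK.
have nab : a != b by apply/eqP => E; move: hab; rewrite E; lia.
have E : chain_inv (tperm a b * w)%g =
    \sum_(p : letter n * letter n)
     ((ht (tt p).1 < ht (tt p).2) && (ht (w p.2) < ht (w p.1)))%N.
  rewrite /chain_inv (reindex_inj (inv_inj ttK)) /=.
  by apply: eq_bigr => -[x y] _; rewrite /= !permM !tpermK.
rewrite E /chain_inv.
have nba : (b, a) != (a, b) by rewrite xpair_eqE eq_sym (negPf nab).
rewrite (bigD1 (a, b)) //= (bigD1 (b, a)) //=.
rewrite [in RHS](bigD1 (a, b)) //= [in RHS](bigD1 (b, a)) //=.
rewrite !tpermL !tpermR hab ltnS leqnn /= ltnNge leqnSn /=.
set S1 := bigop _ _ _; set S2 := bigop _ _ _.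
suff -> : S1 = S2 by lia.
apply: eq_bigr => -[x y] /=; rewrite !xpair_eqE => /andP[n1 n2].
congr (nat_of_bool (_ && _)).
have inj : forall u v, (u == v) = (ht u == ht v) :> bool.
  by move=> u v; rewrite (inj_eq ht_inj).
move: n1 n2; rewrite !inj.
case: tpermP => [->|->|]; case: tpermP => [->|->|] => *; try lia.
all: repeat match goal with H : _ <> _ |- _ =>
  move/eqP in H; rewrite inj in H end; lia.
Qed.

(** Only the last simple reflection changes signs; the others permute the positive letters. The
    factor [next_letter s == bar s] singles it out. *)
Lemma negs_rperm w s : w \in weyl n ->
  (negs (rperm s (next_letter s) * w)%g + (next_letter s == bar s) * (w (pos s)).2
   = negs w + (next_letter s == bar s) * ~~ (w (pos s)).2)%N.
Proof.
move=> /weylP wf; rewrite /next_letter; case: insubP => [t _ st|_].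
  have -> : (pos t == bar s) = false by rewrite xpair_eqE andbF.
  rewrite !mul0n !addn0.
  rewrite /negs (reindex_inj (@perm_inj _ (tperm s t))) /=.
  apply: eq_bigr => k _; rewrite permM rpermE //; last first.
    by rewrite xpair_eqE andbT; apply/eqP => E; move: st; rewrite E /=; lia.
  have posE (x y : 'I_n) : (pos x == pos y) = (x == y).
    by rewrite xpair_eqE andbT.
  rewrite !posE -[flip (pos t)]/(bar t) -![pos _ == bar _]/(_ && false) !andbF.
  case: tpermP => [->|->|/eqP/negPf-> /eqP/negPf-> //]; rewrite ?eqxx //.
  by case: eqP => // ->.
rewrite eqxx !mul1n /negs (bigD1 s) //= [in RHS](bigD1 s) //=.
have bp k : bar s != pos k by rewrite xpair_eqE andbF.
rewrite permM rpermE ?bp // eqxx -[bar s]/(flip (pos s)) wf /=.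
suff -> : (\sum_(k < n | k != s) ((rperm s (flip (pos s)) * w)%g (pos k)).2 =
   \sum_(k < n | k != s) (w (pos k)).2)%N; first by case: (w _).2; rewrite ?addn0 ?add0n addnC.
apply: eq_bigr => k ks; rewrite permM rpermE ?bp // /flip /=.
by rewrite !xpair_eqE /= (negPf ks) ?andbF.
Qed.

(** The change is 2 in both cases: at the last index one self-paired inversion and one negative
    value, elsewhere the two paired inversions at ([pos s], [c]) and ([flip c], [bar s]). *)
Lemma dinv_rperm w s : w \in weyl n ->
  (dinv (rperm s (next_letter s) * w)%g + (ht (w (next_letter s)) < ht (w (pos s))).*2
   = dinv w + (ht (w (pos s)) < ht (w (next_letter s))).*2)%N.
Proof.
move=> ww; have wf := weylP _ ww; have := negs_rperm s ww; rewrite /dinv.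
have := ht_next s; rewrite /rperm; case: (eqVneq _ (bar s)) => [->|nb] hs.
  have := chain_inv_tperm w (hs : ht (bar s) = (ht (pos s)).+1).
  rewrite -[bar s]/(flip (pos s)) wf ht_ltflip.
  have -> : (ht (w (pos s)) < ht (flip (w (pos s))))%N = ~~ (w (pos s)).2.
    by rewrite -{1}(flipK (w (pos s))) ht_ltflip.
  rewrite !mul1n; move: (chain_inv _) (negs _) (chain_inv _) (negs _) => x1 x2 x3 x4.
  by case: (w (pos s)).2 => /=; clear; lia.
set c := next_letter s in hs nb *.
rewrite !mul0n !addn0 => ->.
have h2 : ht (bar s) = (ht (flip c)).+1.
  rewrite -[bar s]/(flip (pos s)) !ht_flip; move: hs.
  have := ht_lt c; have := ltn_ord s; rewrite [ht (pos s)]/ht /=; lia.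
have E1 := chain_inv_tperm (tperm (bar s) (flip c) * w)%g (hs : ht c = (ht (pos s)).+1).
have := chain_inv_tperm w h2; rewrite tpermC.
have d1 : tperm (bar s) (flip c) (pos s) = pos s.
  rewrite tpermD //; apply: contraNneq nb => E; by rewrite -(flipK c) E.
have d2 : tperm (bar s) (flip c) c = c.
  by rewrite tpermD ?flip_neq // eq_sym.
move: E1; rewrite !permM d1 d2 mulgA -[bar s]/(flip (pos s)) !wf !ht_flip2.
move: (ht _ < _) (ht _ < _) (chain_inv _) (chain_inv _) (chain_inv _) (negs _) => x y a b d e.
by clear; lia.
Qed.

End Letters.

(** * Reduced words *)

Section Words.
Local Open Scope nat_scope.
Variable n : nat.
Implicit Types (a b c x y : letter n) (w : {perm letter n}) (s t j k : 'I_n).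

Lemma ht_small a : (ht a < n) = ~~ a.2.
Proof. by case: a => s []; rewrite /ht /=; have := ltn_ord s; lia. Qed.

Lemma rpermK s c : c != pos s -> (rperm s c * rperm s c = 1)%g.
Proof.
move=> cs; apply/permP => a; rewrite permM perm1 !rpermE //.
move/eqP: cs => cs; have fc := elimN eqP (flip_neq c).
have ffc := flipK c; have fp : flip (pos s) = bar s by [].
have fb : flip (bar s) = pos s by [].
have pb : pos s <> bar s by [].
by do !case: eqP => //; congruence.
Qed.

Lemma next_letter_neq s : next_letter s != pos s.
Proof. by apply/eqP => /(congr1 (@ht n)); rewrite ht_next /ht /=; lia. Qed.

Lemma next_letter_pos s t : t = s.+1 :> nat -> next_letter s = pos t.
Proof.
by move=> ts; apply: ht_inj; rewrite ht_next /ht.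
Qed.

Lemma next_letter_last s : n = s.+1 -> next_letter s = bar s.
Proof. by move=> ns; apply: ht_inj; rewrite ht_next /ht /=; lia. Qed.

(** Strong induction on [k]: all smaller values are already matched, so [f k] is some [g l] with
    [l >= k], whence [g k <= f k]; the reverse inequality is symmetric. *)
Lemma increasing_same_image (m : nat) (f g : 'I_n -> nat) :
    (forall j k, j < k -> k < m -> f j < f k) ->
    (forall j k, j < k -> k < m -> g j < g k) ->
    (forall k, k < m -> exists2 l : 'I_n, l < m & f k = g l) ->
    (forall k, k < m -> exists2 l : 'I_n, l < m & g k = f l) ->
  forall k, k < m -> f k = g k.
Proof.
move=> fi gi fg gf k; have [q] := ubnP k; elim: q k => // q IH k kq km.
have [l lm fkl] := fg k km; have [l' lm' gkl] := gf k km.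
have h1 : k <= l.
  rewrite leqNgt; apply/negP => lk; have := IH l (leq_trans lk kq) lm.
  by have := fi _ _ lk km; lia.
have h2 : k <= l'.
  rewrite leqNgt; apply/negP => lk; have := IH l' (leq_trans lk kq) lm'.
  by have := gi _ _ lk km; lia.
have gl : g k <= g l.
  case: (ltngtP k l) h1 => // [kl _|kl _]; first by have := gi _ _ kl lm; lia.
  by rewrite (val_inj kl).
have fl : f k <= f l'.
  case: (ltngtP k l') h2 => // [kl _|kl _]; first by have := fi _ _ kl lm'; lia.
  by rewrite (val_inj kl).
lia.
Qed.

Lemma ascents_increasing w (lo hi : nat) :
    (forall j, lo <= j < hi -> ht (w (pos j)) < ht (w (next_letter j))) ->
  forall j k, lo <= j -> j < k -> k <= hi -> ht (w (pos j)) < ht (w (pos k)).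
Proof.
move=> up j k loj jk khi.
have [d] := ubnP (k - j); elim: d k jk khi => // d IH k jk khi kd.
have k1n : k.-1 < n by have := ltn_ord k; lia.
pose k1 := Ordinal k1n.
have lt1 : ht (w (pos k1)) < ht (w (pos k)).
  by rewrite -(@next_letter_pos k1 k) /=; [apply: up => /=; lia | lia].
case: (ltngtP j k1) => [jk1|jk1|/val_inj->] //.
  by apply: ltn_trans lt1; apply: IH => //=; lia.
by move: jk1 => /=; lia.
Qed.

(** The ascent at the last index makes the value there positive, hence all values on positive
    letters; an increasing bijection of the positive letters is the identity. *)
Lemma no_descent w : w \in weyl n ->
  (forall s, ht (w (pos s)) < ht (w (next_letter s))) -> w = 1%g.
Proof.
move=> /weylP wf up.
have inc j k : j < k -> k < n -> ht (w (pos j)) < ht (w (pos k)).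
  by move=> jk kn; apply: (@ascents_increasing w 0 n) => // ; apply: ltnW.
have wpos s : ~~ (w (pos s)).2.
  have nn : n.-1 < n by have := ltn_ord s; lia.
  have := up (Ordinal nn); rewrite next_letter_last /=; last by have := ltn_ord s; lia.
  rewrite -[bar _]/(flip (pos _)) wf -{1}(flipK (w _)) ht_ltflip /= -ht_small => h.
  rewrite -ht_small; case: (ltngtP s (Ordinal nn)) => [ls|ls|/val_inj-> //].
    by apply: ltn_trans h; apply: inc.
  by move: ls => /=; have := ltn_ord s; lia.
have wE s : w (pos s) = pos s.
  have wE1 t : w (pos t) = pos (w (pos t)).1.
    by have := wpos t; case: (w _) => u [].
  apply: ht_inj.
  apply: (@increasing_same_image n (fun k => ht (w (pos k))) (fun k => ht (pos k))) => //.
    by move=> k _; exists (w (pos k)).1 => //; rewrite [in LHS]wE1.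
  have inj : injective (fun t => (w (pos t)).1).
    by move=> t u E; have /perm_inj[] : w (pos t) = w (pos u) by rewrite wE1 E -wE1.
  move=> k _; exists (invF inj k) => //.
  by rewrite [in RHS]wE1 (f_invF inj).
apply/permP => -[s []]; rewrite perm1 -?[(s, false)]/(pos s) ?wE //.
by rewrite -[(s, true)]/(flip (pos s)) wf wE.
Qed.

Lemma dinv1 : dinv (1 : {perm letter n})%g = 0.
Proof.
rewrite /dinv /chain_inv /negs !big1 // => [s _|p _]; first by rewrite perm1.
by rewrite !perm1; case: ltngtP.
Qed.

Definition word (r : seq 'I_n) : {perm letter n} :=
  (\prod_(j <- r) rperm j (next_letter j))%g.

Lemma word_weyl r : word r \in weyl n.
Proof.
by apply: group_prod => j _; apply: rperm_weyl; apply: next_letter_neq.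
Qed.

(** The suffix [q] is kept general so that the bound also controls the suffixes of a reduced
    word. *)
Lemma dinv_word r q : dinv (word (r ++ q)) <= (size r).*2 + dinv (word q).
Proof.
elim: r => //= j r IH; have := dinv_rperm j (word_weyl (r ++ q)).
rewrite /word big_cons -/(word (r ++ q)).
move: (dinv _) (dinv _) (dinv _) IH (ht _ < _) (ht _ < _) => x y z IH c d; lia.
Qed.

(** A nontrivial [w] has a descent, and cancelling it lowers [dinv] by 2. *)
Lemma reduced_word w : w \in weyl n ->
  exists2 r, w = word r & dinv w = (size r).*2.
Proof.
have [d] := ubnP (dinv w); elim: d w => // d IH w wd ww.
have [up|] := boolP [forall s, ht (w (pos s)) < ht (w (next_letter s))].
  exists [::]; rewrite (no_descent ww (forallP up)) ?dinv1 //.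
  by rewrite /word big_nil.
rewrite negb_forall => /existsP[s]; rewrite -leqNgt => le_s.
have lt_s : ht (w (next_letter s)) < ht (w (pos s)).
  rewrite ltn_neqAle le_s andbT (inj_eq (@ht_inj n)) (inj_eq perm_inj).
  exact: next_letter_neq.
have := dinv_rperm s ww; rewrite lt_s (ltnNge (ht (w (pos s)))) le_s /= => E.
have [|//|r wr dr] := IH (rperm s (next_letter s) * w)%g; first by lia.
  by rewrite groupM // rperm_weyl // next_letter_neq.
exists (s :: r); last by move: dr => /=; lia.
by rewrite /word big_cons -/(word r) -wr mulgA rpermK ?next_letter_neq // mul1g.
Qed.

(* The suffixes of a reduced word are told apart by [dinv]. *)
Lemma size_reduced_word r : dinv (word r) = (size r).*2 -> size r < #|weyl n|.
Proof.
move=> rr; have dd m : m <= size r -> dinv (word (drop m r)) = (size r - m).*2.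
  move=> mr; have := dinv_word (take m r) (drop m r).
  have := dinv_word (drop m r) [::]; rewrite cats0 cat_take_drop rr.
  by rewrite /word big_nil dinv1 -/(word _) size_drop size_takel //; lia.
have inj : injective (fun m : 'I_(size r).+1 => word (drop m r)).
  have le_r (m : 'I_(size r).+1) : m <= size r by rewrite -ltnS.
  move=> m p /(congr1 (@dinv n)); rewrite !dd // => E.
  by apply: val_inj => /=; have := le_r m; have := le_r p; lia.
have := card_imset setT inj; rewrite cardsT card_ord => <-.
by apply: subset_leq_card; apply/subsetP => _ /imsetP[m _ ->]; apply: word_weyl.
Qed.

End Words.

(** * Roots, reflections and coordinates in terms of letters *)

Section Roots.
Variables (R : realType) (n : nat).
Implicit Types (a b c x y : letter n) (s t i j k : 'I_n) (u v : 'rV[R]_n).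
Local Notation wt := (@wt R n).
Local Notation simple_root := (@simple_root R n).

Lemma wt_coord a k : wt a 0 k = (-1) ^+ a.2 *+ (k == a.1).
Proof. by rewrite /Defs.wt !mxE eqxx mulr_natr. Qed.

Lemma wt_flip a : wt (flip a) = - wt a.
Proof.
rewrite /Defs.wt /flip /=; case: a.2 => /=.
  by rewrite expr0 expr1 scaleN1r scale1r opprK.
by rewrite expr0 expr1 scaleN1r scale1r.
Qed.

Lemma wt_inj : injective wt.
Proof.
move=> a b /rowP E; have := E a.1; rewrite !wt_coord eqxx mulr1n.
case: (eqVneq a.1 b.1) => [ab|_ /eqP]; last by rewrite signr_eq0.
rewrite mulr1n => /eqP; case: a b ab {E} => s [] [t []] /= ->; rewrite ?expr0 ?expr1 //.
  by rewrite eq_sym -addr_eq0 -[1 + 1]/(2%:R) pnatr_eq0.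
by rewrite -addr_eq0 -[1 + 1]/(2%:R) pnatr_eq0.
Qed.

Lemma dotE u v : dot u v = \sum_k u 0 k * v 0 k. Proof. by []. Qed.

Lemma dotBr u v v' : dot u (v - v') = dot u v - dot u v'.
Proof. by rewrite !dotE -sumrB; apply: eq_bigr => k _; rewrite !mxE mulrBr. Qed.

Lemma dotC u v : dot u v = dot v u.
Proof. by rewrite !dotE; apply: eq_bigr => k _; rewrite mulrC. Qed.

Lemma dotZr z u v : dot u (z *: v) = z * dot u v.
Proof. by rewrite !dotE mulr_sumr; apply: eq_bigr => k _; rewrite !mxE mulrCA. Qed.

Lemma dot_wt a b : dot (wt a) (wt b) = (-1) ^+ (a.2 (+) b.2) *+ (a.1 == b.1).
Proof.
rewrite dotE (bigD1 a.1) //= big1 => [|k ka]; last by rewrite wt_coord (negPf ka) mul0r.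
by rewrite !wt_coord eqxx addr0 mulr1n mulrnAr -signr_addb.
Qed.

(** The pairing with the fundamental weight of index [j], which reads off the coefficient of the
    simple coroot [j]. *)
Definition psum j v : R := \sum_(k < n | (k <= j)%N) v 0 k.

Lemma psumD j u v : psum j (u + v) = psum j u + psum j v.
Proof. by rewrite -big_split; apply: eq_bigr => k _; rewrite mxE. Qed.

Lemma psumZ j z v : psum j (z *: v) = z * psum j v.
Proof. by rewrite mulr_sumr; apply: eq_bigr => k _; rewrite mxE. Qed.

Lemma psumB j u v : psum j (u - v) = psum j u - psum j v.
Proof. by rewrite psumD -scaleN1r psumZ mulN1r. Qed.

Lemma psum_wt j a : psum j (wt a) = (-1) ^+ a.2 *+ (a.1 <= j)%N.
Proof.
have [aj|ja] := leqP a.1 j.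
  rewrite /psum (bigD1 a.1) //= wt_coord eqxx big1 ?addr0 // => k /andP[_ ka].
  by rewrite wt_coord (negPf ka).
rewrite /psum big1 // => k kj; rewrite wt_coord; case: eqP => // ka.
by move: ja; rewrite -ka ltnNge kj.
Qed.

(* Every positive root is the difference of the weights of a positive letter
   and of a later one; the reflection swaps these two letters. *)
Definition root_of s c := wt (pos s) - wt c.

(** The first alternative gives the short roots [eps_s + eps_t] and [eps_s - eps_t], the second the
    long root [2 eps_s]. *)
Definition root_index s c := (s < c.1)%N || (c == bar s).

Lemma root_index_neq s c : root_index s c -> c != pos s.
Proof. by case/orP => [sc|/eqP->]; apply/eqP => // cs; move: sc; rewrite cs ltnn. Qed.

Lemma wt_bar s : wt (bar s) = - wt (pos s).
Proof. exact: (wt_flip (pos s)). Qed.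

Lemma wt_pos s : wt (pos s) = eps R s.
Proof. by rewrite /Defs.wt expr0 scale1r. Qed.

Lemma simple_rootE s : simple_root s = root_of s (next_letter s).
Proof.
rewrite /Defs.simple_root /root_of /next_letter.
by case: insubP => [t _ _|_]; rewrite ?wt_bar !wt_pos // opprK scaler_nat mulr2n.
Qed.

Lemma next_letter_index s : root_index s (next_letter s).
Proof.
rewrite /root_index /next_letter; case: insubP => [t _ ts|_]; last by rewrite eqxx orbT.
by move: ts => /= ->; rewrite ltnSn.
Qed.

Lemma dot_root_of s c : root_index s c ->
  dot (root_of s c) (root_of s c) = if c == bar s then 4 else 2.
Proof.
move=> sc; rewrite /root_of dotBr !(dotC (_ - _)) !dotBr !dot_wt !eqxx addbb.
case: (eqVneq c (bar s)) sc => [->|cb].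
  by rewrite /= eqxx /= expr1 expr0 !mulr1n => _; lra.
rewrite /root_index (negPf cb) orbF => sc.
have -> : (s == c.1) = false by apply/eqP => E; move: sc; rewrite -E ltnn.
have -> : (c.1 == s) = false by apply/eqP => E; move: sc; rewrite -E ltnn.
by rewrite addbb expr0 !mulr0n /=; lra.
Qed.

Lemma coroot_root_of s c : root_index s c ->
  coroot (root_of s c) = if c == bar s then eps R s else root_of s c.
Proof.
move=> sc; rewrite /coroot dot_root_of //; case: eqP => [->|_].
  rewrite /root_of wt_bar opprK wt_pos -mulr2n -scaler_nat scalerA.
  by rewrite (_ : 2 / 4 * 2 = 1) ?scale1r //; lra.
by rewrite divff ?scale1r // pnatr_eq0.
Qed.

(** A letter other than [pos s], [c] and their flips has weight orthogonal to the root; the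
    remaining cases are the swap and its mirror image. *)
Lemma reflect_root_of s c a : root_index s c ->
  reflect_vec (root_of s c) (wt a) = wt (rperm s c a).
Proof.
move=> sc; rewrite /reflect_vec coroot_root_of // rpermE ?root_index_neq //.
case: (eqVneq c (bar s)) sc => [->|cb] sc.
  rewrite -wt_pos dot_wt /root_of wt_bar opprK addbF.
  case: (eqVneq a (pos s)) => [->|ap].
    by rewrite /= eqxx expr0 scale1r wt_bar opprD addrA subrr add0r.
  case: (eqVneq a (bar s)) => [->|ab].
    by rewrite /= eqxx expr1 mulr1n scaleN1r opprK wt_bar addKr.
  have -> : (a.1 == s) = false.
    by apply/eqP => E; case: a ap ab E => k [] /= ap ab E; move: ap ab; rewrite E ?eqxx.
  rewrite mulr0n scale0r subr0.
  by case: (eqVneq a (flip (bar s))) => // E; rewrite E eqxx in ap.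
rewrite /root_index (negPf cb) orbF in sc.
have sc1 : (s == c.1) = false by apply/eqP => E; move: sc; rewrite -E ltnn.
have sc2 : (c.1 == s) = false by rewrite eq_sym.
rewrite dotBr !dot_wt.
case: (eqVneq a (pos s)) => [->|ap].
  by rewrite /= eqxx sc1 expr0 mulr0n subr0 scale1r opprB addrC subrK.
case: (eqVneq a c) => [->|ac].
  by rewrite sc2 eqxx addbb expr0 mulr0n sub0r scaleN1r opprK addrC subrK.
case: (eqVneq a (bar s)) => [->|ab].
  by rewrite /= eqxx sc1 expr1 mulr1n mulr0n subr0 scaleN1r opprK wt_bar wt_flip addKr.
case: (eqVneq a (flip c)) => [->|af].
  rewrite /= sc2 eqxx mulr0n sub0r wt_bar wt_flip addNb addbb expr1 mulr1n opprK.
  by rewrite scale1r opprB addrA addNr add0r.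
have ne b : a != b -> a != flip b -> (a.1 == b.1) = false.
  move=> n1 n2; apply/eqP => E; move: n1 n2.
  by case: a b E {ap ac ab af} => [k []] [l []] /= ->; rewrite ?eqxx.
by rewrite !ne // !mulr0n subr0 scale0r subr0.
Qed.

(** Weights determine letters, so [rperm s c] is the only permutation that [pick] can return, and
    the default value is never reached. *)
Lemma refl_root_of s c : root_index s c -> refl (root_of s c) = rperm s c.
Proof.
move=> sc; rewrite /refl; case: pickP => [w /andP[_ /forallP wE]|/(_ (rperm s c))].
  by apply/permP => a; apply: wt_inj; rewrite (eqP (wE a)) reflect_root_of.
rewrite rperm_weyl ?root_index_neq //= => /forallP[] a.
by rewrite reflect_root_of.
Qed.

(** A dual family of functionals shows that [e] is free, hence a basis by dimension; applied to the
    expansion of [v] it identifies [coord]. *)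
Lemma coord_dual (e : n.-tuple 'rV[R]_n) (f : 'I_n -> 'rV[R]_n -> R) :
    (forall j, {morph f j : u v / u + v}) ->
    (forall j z v, f j (z *: v) = z * f j v) ->
    (forall j l : 'I_n, f j e`_l = (j == l)%:R) ->
  basis_of fullv e /\ forall j v, coord e j v = f j v.
Proof.
move=> fD fZ fe.
have f0 j : f j 0 = 0 by rewrite -(scale0r 0) fZ mul0r.
have fsum j (z : 'I_n -> R) : f j (\sum_l z l *: e`_l) = z j.
  rewrite (big_morph _ (fD j) (f0 j)) (bigD1 j) //= fZ fe eqxx mulr1.
  by rewrite big1 ?addr0 // => l lj; rewrite fZ fe eq_sym (negPf lj) mulr0.
have fr : free e by apply/freeP => z z0 j; rewrite -(fsum j z) z0 f0.
have be : basis_of fullv e.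
  by rewrite basisEfree fr subvf dimvf dim_matrix mul1r size_tuple leqnn.
by split=> // j v; rewrite {2}(coord_basis be (memvf v)) fsum.
Qed.

Lemma psum_root_of j s c :
  psum j (root_of s c) = (s <= j)%N%:R - (-1) ^+ c.2 *+ (c.1 <= j)%N.
Proof. by rewrite psumB !psum_wt expr0. Qed.

Lemma psum_simple j l : psum j (simple_root l) =
  if l == j then (if l.+1 == n then 2 else 1) else 0.
Proof.
rewrite simple_rootE psum_root_of; case: (eqVneq l.+1 n) => [ln|ln].
  rewrite next_letter_last //= expr1 mulNrn opprK -natrD.
  case: (eqVneq l j) => [->|lj]; first by rewrite leqnn.
  rewrite (_ : (l <= j)%N = false) //.
  apply/negbTE/negP => h; case/eqP: lj; apply: val_inj => /=; have := ltn_ord j; lia.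
have l1 : (l.+1 < n)%N by have := ltn_ord l; lia.
rewrite (@next_letter_pos _ l (Ordinal l1)) //= expr0.
case: (eqVneq l j) => [->|/eqP lj]; first by rewrite leqnn ltnn subr0.
have {}lj : (l : nat) <> j by move/val_inj.
by rewrite (_ : (l < j)%N = (l <= j)%N) ?subrr //; lia.
Qed.

(** The last simple root is twice a basis vector, hence the halving. *)
Definition coef j v : R := if j.+1 == n then psum j v / 2 else psum j v.

Lemma coord_simple j v : coord (simple_roots R n) j v = coef j v.
Proof.
apply: (proj2 (coord_dual _ _ _)) => {j v} [j u v|j z v|j l]; rewrite /coef.
- by case: ifP => _; rewrite psumD // mulrDl.
- by case: ifP => _; rewrite psumZ // mulrA.
rewrite -tnth_nth tnth_mktuple psum_simple [j == l]eq_sym.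
by case: (eqVneq l j) => [->|_]; case: (_ == n); rewrite ?mul0r ?divff ?pnatr_eq0.
Qed.

(** No halving occurs for coroots, since the last simple coroot is the basis vector itself. *)
Lemma simple_coroots_dual : basis_of fullv (simple_coroots R n) /\
  forall j v, coord (simple_coroots R n) j v = psum j v.
Proof.
apply: coord_dual => [j u v|j z v|j l].
- exact: psumD.
- exact: psumZ.
rewrite -tnth_nth tnth_mktuple simple_rootE coroot_root_of ?next_letter_index //.
case: (eqVneq l.+1 n) => [ln|ln].
  rewrite next_letter_last // eqxx -wt_pos psum_wt expr0.
  rewrite (_ : (l <= j)%N = (j == l)) //.
  by apply/idP/eqP => [h|-> //]; apply: val_inj => /=; have := ltn_ord j; lia.
have l1 : (l.+1 < n)%N by have := ltn_ord l; lia.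
rewrite ifN; last by rewrite (@next_letter_pos _ l (Ordinal l1)) // xpair_eqE andbF.
by rewrite -simple_rootE psum_simple (negPf ln) [j == l]eq_sym; case: eqVneq.
Qed.

Lemma eps_sum_simple_coroots i :
  eps R i = \sum_(j < n | (i <= j)%N) coroot (simple_root j).
Proof.
have [b cE] := simple_coroots_dual.
rewrite (coord_basis b (memvf (eps R i))) [RHS]big_mkcond; apply: eq_bigr => j _.
rewrite cE -tnth_nth tnth_mktuple -wt_pos psum_wt expr0 /=.
by case: (i <= j)%N; rewrite ?scale1r ?scale0r.
Qed.

End Roots.

(** * The positive roots and the vector [rho - rho_J] *)

Section PositiveRoots.
Variables (R : realType) (n : nat).
Implicit Types (a b c : letter n) (s t i j k : 'I_n) (g u v : 'rV[R]_n).
Local Notation root_of := (@root_of R n).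
Local Notation psum := (@psum R n).

Lemma rootsP g :
  reflect (exists s c, root_index s c /\ (g = root_of s c \/ g = - root_of s c))
          (g \in Defs.roots R n).
Proof.
(* The sign of [t] is negated because [root_of] subtracts the weight of its second letter. *)
have E (e b : bool) s t :
    (-1) ^+ nat_of_bool e *: (eps R s + (-1) ^+ nat_of_bool b *: eps R t) =
    (-1) ^+ nat_of_bool e *: root_of s (t, ~~ b).
  congr (_ *: _); rewrite /root_of wt_pos -[(t, ~~ b)]/(flip (t, b)) wt_flip opprK.
  by [].
have E2 (e : bool) s : (-1) ^+ nat_of_bool e *: (2 *: eps R s) =
    (-1) ^+ nat_of_bool e *: root_of s (bar s).
  by rewrite /root_of wt_bar wt_pos opprK scaler_nat.
rewrite /Defs.roots mem_undup mem_cat; apply: (iffP orP).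
  case=> /imageP[] => [[[e b] [s t]] /= | [e s] /= _].
    rewrite inE /= => st ->; exists s, (t, ~~ b); split; first by rewrite /root_index st.
    by rewrite E; case: (e) => /=; rewrite ?expr0 ?expr1 ?scale1r ?scaleN1r; [right|left].
  move=> ->; exists s, (bar s); split; first by rewrite /root_index eqxx orbT.
  by rewrite E2; case: (e) => /=; rewrite ?expr0 ?expr1 ?scale1r ?scaleN1r; [right|left].
move=> [s [[t b] [/orP[/= st|/eqP->] gE]]]; [left|right]; apply/imageP.
  by case: gE => ->; [exists ((false, ~~ b), (s, t))|exists ((true, ~~ b), (s, t))];
     rewrite ?inE // E /= negbK ?expr0 ?expr1 ?scale1r ?scaleN1r.
by case: gE => ->; [exists (false, s)|exists (true, s)];
   rewrite // E2 /= ?expr0 ?expr1 ?scale1r ?scaleN1r.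
Qed.

Lemma coef_root_of_nat j s c : root_index s c -> coef j (root_of s c) \is a Num.nat.
Proof.
move=> sc; have scj : (c.1 <= j -> s <= j)%N.
  by case/orP: sc => [sc|/eqP->//]; lia.
rewrite /coef psum_root_of; case: eqP => [jn|_].
  have le k : (k <= j)%N by have := ltn_ord k; lia.
  rewrite !le; case: c.2 => /=.
    by rewrite expr1 mulr1n opprK -[1 + 1]/(2%:R) divff ?pnatr_eq0 // rpred1.
  by rewrite expr0 mulr1n subrr mul0r rpred0.
case: c.2 => /=; first by rewrite expr1 mulNrn opprK -natrD natr_nat.
rewrite expr0; case: (c.1 <= j)%N scj => [->//|_]; first by rewrite subrr rpred0.
by rewrite mulr0n subr0 natr_nat.
Qed.

(** This coefficient tells a root from its negative, and lets [s] be recovered as the first index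
    with a nonzero coefficient. *)
Lemma coef_root_of_gt0 s c : root_index s c -> 0 < coef s (root_of s c).
Proof.
move=> sc; have p : 0 < psum s (root_of s c).
  rewrite psum_root_of leqnn; case/orP: sc => [sc|/eqP->].
    by rewrite leqNgt sc mulr0n subr0 ltr01.
  by rewrite /= leqnn expr1 mulr1n opprK addr_gt0.
by rewrite /coef; case: ifP => // _; rewrite divr_gt0.
Qed.

Lemma coefN j v : coef j (- v) = - coef j v.
Proof. by rewrite -scaleN1r /coef psumZ; case: ifP => _; rewrite mulN1r // mulNr. Qed.

Lemma pos_rootsP g :
  reflect (exists s c, root_index s c /\ g = root_of s c) (g \in pos_roots R n).
Proof.
rewrite mem_filter; apply: (iffP andP) => [[/forallP nn /rootsP]|].
  move=> [s [c [sc [->|gE]]]]; first by exists s, c.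
  have := natr_ge0 (nn s); rewrite gE coord_simple coefN oppr_ge0.
  by rewrite leNgt coef_root_of_gt0.
move=> [s [c [sc ->]]]; split; last by apply/rootsP; exists s, c; split; [|left].
by apply/forallP => j; rewrite coord_simple coef_root_of_nat.
Qed.

(** The coefficients are natural numbers, so integrality is automatic and only the vanishing at [i]
    remains. *)
Lemma in_root_lattice_root_of i s c : root_index s c ->
  in_root_lattice [set~ i] (root_of s c) = (psum i (root_of s c) == 0).
Proof.
move=> sc; have ci : (coef i (root_of s c) == 0) = (psum i (root_of s c) == 0).
  by rewrite /coef; case: ifP => // _; rewrite mulf_eq0 invr_eq0 pnatr_eq0 orbF.
rewrite -ci; apply/forallP/idP => [/(_ i)|ci0 j].
  by rewrite !inE eqxx coord_simple.
rewrite !inE coord_simple; case: eqVneq => [->|_] //=.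
by rewrite intrE coef_root_of_nat.
Qed.

Lemma root_of_inj s c s' c' : root_index s c -> root_index s' c' ->
  root_of s c = root_of s' c' -> s = s' /\ c = c'.
Proof.
have le : forall s c s' c', root_index s c -> root_index s' c' ->
    root_of s c = root_of s' c' -> (s' <= s)%N.
  move=> {}s {}c {}s' {}c' sc sc' E; rewrite leqNgt; apply/negP => ss'.
  have p : psum s (root_of s' c') = 0.
    rewrite psum_root_of; have cs : (s < c'.1)%N by case/orP: sc' => [|/eqP->//]; lia.
    by rewrite leqNgt ss' leqNgt cs subr0.
  have := coef_root_of_gt0 sc; rewrite E /coef p.
  by case: ifP => _; rewrite ?mul0r ltxx.
move=> sc sc' E; have ss' : s = s'.
  by apply: val_inj; apply/eqP; rewrite eqn_leq (le _ _ _ _ sc' sc) // (le _ _ _ _ sc sc').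
by split=> //; move: E; rewrite /root_of ss' => /addrI/oppr_inj/(@wt_inj R n).
Qed.

Lemma uniq_pos_roots : uniq (pos_roots R n).
Proof. exact/filter_uniq/undup_uniq. Qed.

Lemma perm_pos_roots :
  perm_eq (pos_roots R n)
    [seq root_of p.1 p.2 | p <- enum [pred p : 'I_n * letter n | root_index p.1 p.2]].
Proof.
apply: uniq_perm; first exact: uniq_pos_roots.
  rewrite map_inj_in_uniq ?enum_uniq // => -[s c] [s' c'].
  by rewrite !mem_enum !inE /= => sc sc' /(root_of_inj sc sc')[-> ->].
move=> g; apply/pos_rootsP/mapP.
  by move=> [s [c [sc ->]]]; exists (s, c); rewrite ?mem_enum.
by move=> [[s c]]; rewrite mem_enum inE /= => sc ->; exists s, c.
Qed.

(** Only the roots involving [alpha_i] survive. For [s <= i] the coefficient of [eps_s] in their sum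
    is 2 from [2 eps_s], 2 for each [t > i] and 1 for each other [t <= i]: in total
    [2 + 2 (n - i - 1) + i = 2n - i], with [i] counted from 0. *)
Lemma rho_diff i :
  rho R n - rho_of R [set~ i] = ((n.*2 - i)%N%:R / 2) *: \sum_(k < n | (k <= i)%N) eps R k.
Proof.
rewrite /rho /rho_of /pos_roots_of -scalerBr [X in _ - X]big_filter.
rewrite [X in X - _](bigID (in_root_lattice [set~ i])) /= addrAC subrr add0r.
rewrite (perm_big _ perm_pos_roots) big_map /= big_enum_cond /=.
rewrite mulrC -scalerA; congr (_ *: _).
rewrite (eq_bigl (fun p : 'I_n * letter n => root_index p.1 p.2 &&
    (psum i (root_of p.1 p.2) != 0))); last first.
  move=> p /=; rewrite inE; case: (boolP (root_index _ _)) => //= sc.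
  by rewrite in_root_lattice_root_of.
rewrite big_mkcond /= -(pair_bigA _ (fun s c => if root_index s c &&
    (psum i (root_of s c) != 0) then root_of s c else 0)) /=.
pose F s t := \sum_(b : bool)
   if root_index s (t, b) && (psum i (root_of s (t, b)) != 0) then root_of s (t, b) else 0.
transitivity (\sum_(s < n) \sum_(t < n) F s t).
  apply: eq_bigr => s _; rewrite /F pair_bigA /=.
  by apply: eq_bigr => -[t b].
(* For [s <= i < t] both [eps_s + eps_t] and [eps_s - eps_t] survive and their [eps_t] parts cancel;
   for [s < t <= i] only the sum survives. *)
have FE s t : F s t = if (s <= i)%N then
    eps R s *+ ((t == s).*2 + (s < t) * (1 + (i < t)))%N
      + eps R t *+ ((s < t) && (t <= i))%N
  else 0.
  rewrite /F big_bool /root_index !psum_root_of /= /root_of wt_pos.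
  rewrite -[(t, true)]/(bar t) -[(t, false)]/(pos t) wt_bar wt_pos opprK.
  have -> : (bar t == bar s) = (t == s) by rewrite xpair_eqE andbT.
  have -> : (pos t == bar s) = false by rewrite xpair_eqE andbF.
  rewrite expr0 expr1 orbF mulNrn opprK.
  have [ti|it] := leqP t i; have [si|is_] := leqP s i => /=.
  - rewrite subrr eqxx andbF addr0 -[1 + 1]/(2%:R) pnatr_eq0 /= andbT addn0 muln1.
    case: (ssrnat.ltngtP s t) => [st|ts|/val_inj->].
    + rewrite orTb (_ : (t == s) = false) ?mulr1n //.
      by apply/eqP => E; move: st; rewrite E ltnn.
    + rewrite orFb (_ : (t == s) = false) ?addr0 //.
      by apply/eqP => E; move: ts; rewrite E ltnn.
    + by rewrite eqxx mulr0n addr0 mulr2n.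
  - have st : (s < t)%N = false by lia.
    have -> : (t == s) = false by apply/eqP => E; move: ti; rewrite E; lia.
    by rewrite st /= addr0.
  - have st : (s < t)%N by lia.
    have -> : (t == s) = false by apply/eqP => E; move: it; rewrite E; lia.
    by rewrite st /= !subr0 addr0 oner_neq0 addrACA subrr addr0.
  - by rewrite subrr addr0 eqxx !andbF addr0.
pose N s t := ((t == s).*2 + (s < t) * (1 + (i < t)))%N.
(* Exchanging the sums credits each [eps_t] term to the index [t]; after renaming this is the
   summand [t < s]. *)
transitivity (\sum_(s < n | (s <= i)%N) \sum_(t < n) (eps R s *+ (N s t + (t < s)%N))).
  under eq_bigr => s _ do under eq_bigr => t _ do rewrite FE.
  rewrite [RHS]big_mkcond /=.
  transitivity (\sum_(s < n) ((if (s <= i)%N then \sum_(t < n) eps R s *+ N s t else 0) +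
      \sum_(t < n) eps R t *+ ((s < t) && (t <= i))%N)).
    apply: eq_bigr => s _; case: leqP => si; first by rewrite big_split.
    rewrite add0r !big1 // => t _; case: (ltnP s t) => //= st.
    by rewrite leqNgt (ltn_trans si st).
  rewrite big_split /= [X in _ + X]exchange_big -big_split /=; apply: eq_bigr => s _.
  case: leqP => si; last by rewrite add0r big1 // => t _; rewrite andbF.
  by rewrite -big_split /=; apply: eq_bigr => t _; rewrite andbT /N !mulrnDr.
rewrite scaler_sumr; apply: eq_bigr => s si.
rewrite sumrMnr scaler_nat; congr (_ *+ _).
transitivity (\sum_(t < n) ((t == s) + 1 + (i < t)))%N.
  apply: eq_bigr => t _; rewrite /N; case: (ssrnat.ltngtP s t) => [st|ts|/val_inj st].
  - rewrite (_ : (t == s) = false); last by apply/eqP => E; move: st; rewrite E ltnn.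
    by rewrite /= mul1n addn0.
  - have -> : (i < t)%N = false by lia.
    by rewrite (_ : (t == s) = false) //; apply/eqP => E; move: ts; rewrite E ltnn.
  - by rewrite -st eqxx ltnNge si.
rewrite !big_split /= sum1_card card_ord (bigD1 s) //= eqxx big1 ?addn0; last first.
  by move=> t /negPf->.
have -> : (\sum_(t < n) (i < t) = n - i.+1)%N.
  rewrite -(big_mkord xpredT (fun t : nat => nat_of_bool (i < t)%N)).
  rewrite (@big_cat_nat _ _ _ i.+1) //=.
  rewrite big_nat big1 => [|t /andP[_ ti]]; last by rewrite ltnNge -ltnS ti.
  rewrite big_nat (eq_bigr (fun=> 1%N)) => [|t /andP[-> _]] //.
  by rewrite -big_nat sum_nat_const_nat muln1.
by have := ltn_ord i; lia.
Qed.

End PositiveRoots.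

(** * The length statistic in terms of a set of values *)

Section LetterSets.
Local Open Scope nat_scope.
Variable n : nat.
Implicit Types (a b c x y : letter n) (w : {perm letter n}) (s t i j k : 'I_n).
Implicit Types (A B : {set letter n}).

(** [ht] is a bijection onto the integers below [2n]. *)
Lemma sum_ht_lt a : \sum_(y : letter n) (ht y < ht a) = ht a.
Proof.
pose f (y : letter n) : 'I_(n.*2) := Ordinal (ht_lt y).
have fi : injective f by move=> x y [] /ht_inj.
have fb : bijective f.
  by apply: inj_card_bij => //; rewrite card_prod !card_ord card_bool muln2.
have [f' fK f'K] := fb.
transitivity (\sum_(k < n.*2) (k < ht a)).
  rewrite (reindex f) /=; first by [].
  by exists f' => x _; rewrite ?fK ?f'K.
transitivity (\sum_(k < n.*2 | k < ht a) 1).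
  by rewrite [RHS]big_mkcond; apply: eq_bigr => k _; case: ifP.
rewrite -(big_mkord (fun k : nat => k < ht a) (fun=> 1)).
rewrite -(big_nat_widen 0 (ht a) n.*2 xpredT) ?sum_nat_const_nat ?subn0 ?muln1 //.
exact/ltnW/ht_lt.
Qed.

Definition sum_ht A : nat := \sum_(a in A) ht a.

(** The condition is symmetric in [a] and [b] by [ht_flipC], so every unordered pair is counted
    twice. *)
Definition neg_pairs A : nat :=
  \sum_(a in A) \sum_(b in A | b != a) (ht (flip b) < ht a).

Definition free_below B a : nat := \sum_(c | flip c \notin B) (ht c < ht a).

(* [2 * free_below B a] is the contribution of [a] to [2 * sum_ht A - neg_pairs A]
   when [A = a |: B]; subtractions are avoided by adding across. *)
Lemma exchange_letter B a a' : a \notin B -> a' \notin B ->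
  2 * sum_ht (a |: B) + neg_pairs (a' |: B) + 2 * free_below B a' =
  2 * sum_ht (a' |: B) + neg_pairs (a |: B) + 2 * free_below B a.
Proof.
(* The letters below [c] are split by whether their flip lies in [B]; the number of those that do is
   half of what [c] adds to [neg_pairs]. *)
have htE c : ht c = free_below B c + \sum_(b in B) (ht (flip b) < ht c).
  rewrite -[LHS]sum_ht_lt (bigID (fun x => flip x \notin B)) /=; congr (_ + _).
  rewrite [RHS](reindex_inj (inv_inj (@flipK n))) /=.
  by apply: eq_big => x; rewrite ?negbK // flipK.
have np c : c \notin B ->
    neg_pairs (c |: B) = neg_pairs B + (\sum_(b in B) (ht (flip b) < ht c)).*2.
  move=> cB; rewrite /neg_pairs big_setU1 //=.
  have bc b : b \in B -> b != c by move=> bB; apply: contraNneq cB => <-.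
  have -> : \sum_(b in c |: B | b != c) (ht (flip b) < ht c) =
            \sum_(b in B) (ht (flip b) < ht c).
    apply: eq_bigl => b; rewrite !inE; case: (eqVneq b c) => [->|] /=; last by rewrite andbT.
    by rewrite (negPf cB).
  have -> : \sum_(x in B) \sum_(b in c |: B | b != x) (ht (flip b) < ht x) =
     \sum_(x in B) ((ht (flip x) < ht c) + \sum_(b in B | b != x) (ht (flip b) < ht x)).
    apply: eq_bigr => x xB; rewrite big_mkcondr big_setU1 //= eq_sym bc //.
    by rewrite ht_flipC -big_mkcondr.
  by rewrite big_split /= -addnn; lia.
have sh c : c \notin B -> sum_ht (c |: B) = ht c + sum_ht B.
  by move=> cB; rewrite /sum_ht big_setU1.
move=> aB a'B; rewrite !np // !sh //.
move: (htE a) (htE a').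
set S := \sum_(b in B) (_ < ht a); set S' := \sum_(b in B) (_ < ht a').
move: S S' (sum_ht B) (neg_pairs B) (free_below _ _) (free_below _ _) (ht a) (ht a').
by clear; lia.
Qed.

Lemma free_belowE B a : free_below B a = #|[set c | (flip c \notin B) && (ht c < ht a)]|.
Proof.
rewrite -sum1_card big_mkcond /free_below [LHS]big_mkcond; apply: eq_bigr => c _.
by rewrite inE; do 2 case: (_ \notin _) => //=; case: (_ < _).
Qed.

Lemma card_free B a : flip a \notin B ->
  #|[set c | (flip c \notin B) && (c != a)]| = n.*2.-1 - #|B|.
Proof.
move=> aB; have -> : [set c | (flip c \notin B) && (c != a)] = ~: (a |: (@flip n) @^-1: B).
  by apply/setP => c; rewrite !inE negb_or andbC.
rewrite cardsCs setCK cardsU1 !inE aB card_prod card_ord card_bool muln2.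
by rewrite card_preimset /=; [move: #|B| => m; clear; lia | apply/inv_inj/flipK].
Qed.

(** The letter [a] is itself among the candidates and does not lie below itself, hence the
    predecessor. *)
Lemma free_below_le B a : flip a \notin B -> free_below B a <= n.*2.-1 - #|B|.
Proof.
move=> aB; rewrite -(card_free aB) free_belowE; apply/subset_leq_card/subsetP => c.
by rewrite !inE => /andP[-> ca]; apply: contraTneq ca => ->; rewrite ltnn.
Qed.

(** The gap forces the maximum at [a] and the value 0 at [a']: among the letters whose flip avoids
    [B], [a] is the last and [a'] precedes or equals all. *)
Lemma free_below_extreme B a a' s : s = 0 :> nat ->
    (forall b, b \in B -> flip b \notin B) ->
    a \notin B -> a' \notin B -> flip a \notin B ->
  free_below B a = free_below B a' + (n.*2.-1 - #|B|) -> a = bar s /\ a' = pos s.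
Proof.
move=> s0 BB aB a'B faB E; have := free_below_le faB => le.
have {E} [ga ga'] : free_below B a = n.*2.-1 - #|B| /\ free_below B a' = 0 by lia.
have top c : flip c \notin B -> ht c <= ht a.
  move=> cB; case: (eqVneq c a) => [->//|ca]; apply: ltnW.
  have /eqP S : [set c | (flip c \notin B) && (ht c < ht a)] ==
         [set c | (flip c \notin B) && (c != a)].
    rewrite eqEcard card_free // -free_belowE ga leqnn andbT; apply/subsetP => d.
    by rewrite !inE => /andP[-> da]; apply: contraTneq da => ->; rewrite ltnn.
  by have /setP/(_ c) := S; rewrite !inE cB ca /=.
have bot c : flip c \notin B -> ht a' <= ht c.
  move=> cB; rewrite leqNgt; apply/negP => lt.
  move: ga'; rewrite free_belowE => /eqP; rewrite cards_eq0 => /eqP/setP/(_ c).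
  by rewrite !inE cB lt.
have n0 : 0 < n by have := ltn_ord s; lia.
have eqa : pos s \notin B -> a = bar s.
  move=> h; apply: ht_inj; apply/eqP; rewrite eqn_leq (top (bar s)) // andbT.
  have -> : ht (bar s) = n.*2.-1 by rewrite /ht /= s0 subn0.
  by have := ht_lt a; lia.
have eqa' : bar s \notin B -> a' = pos s.
  move=> h; apply: ht_inj; apply/eqP; rewrite eqn_leq (bot (pos s)) //=.
  by have -> : ht (pos s) = 0 by [].
(* If [pos s] were in [B], its flip would not be, so [a'] would equal [pos s] and lie in [B]. *)
have [sB|sB] := boolP (pos s \in B).
  by have := eqa' (BB _ sB) => E; rewrite E sB in a'B.
have a0 := eqa sB; split=> //; apply: eqa'.
by rewrite -a0.
Qed.

(** With indices from 0 these are the first [i + 1] letters of the chain. *)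
Definition pos_upto i : {set letter n} := [set a : letter n | ~~ a.2 && (a.1 <= i)].

Definition ascending_off i w :=
  forall j, j != i -> ht (w (pos j)) < ht (w (next_letter j)).

Section Ascending.
Variables (i : 'I_n) (w : {perm letter n}).
Hypotheses (ww : w \in weyl n) (up : ascending_off i w).

Lemma ascending_prefix j k : j < k -> k <= i -> ht (w (pos j)) < ht (w (pos k)).
Proof.
move=> jk ki; apply: (@ascents_increasing n w 0 i) => // l /= li.
by apply: up; apply/eqP => E; move: li; rewrite E ltnn.
Qed.

Lemma ascending_suffix j k : i < j -> j < k -> ht (w (pos j)) < ht (w (pos k)).
Proof.
move=> ij jk; apply: (@ascents_increasing n w i.+1 n) => //; last exact: ltnW.
move=> l /= /andP[il _].
by apply: up; apply/eqP => E; move: il; rewrite E ltnn.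
Qed.

(** The last index differs from [i], so it carries an ascent, which makes its value positive; the
    values at the earlier indices beyond [i] are smaller. *)
Lemma ascending_suffix_pos j : i < j -> (w (pos j)).2 = false.
Proof.
have wf := weylP _ ww => ij; have nn : n.-1 < n by have := ltn_ord j; lia.
pose l := Ordinal nn; have il : i < l by rewrite /l /=; have := ltn_ord j; lia.
have := up (j := l); rewrite next_letter_last /=; last by have := ltn_ord j; lia.
rewrite -[bar _]/(flip (pos _)) wf => /(_ _).
have li : l != i by apply/eqP => E; move: il; rewrite E ltnn.
move=> /(_ li); rewrite -{1}(flipK (w _)) ht_ltflip /= => h.
apply/negbTE; rewrite -ht_small; rewrite -ht_small in h.
case: (ssrnat.ltngtP j l) => [jl|lj|/val_inj->//].
  by apply: ltn_trans h; apply: ascending_suffix.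
by move: lj => /=; have := ltn_ord j; lia.
Qed.

Definition above : {set letter n} := [set a : letter n | i < a.1].
Definition neg_upto : {set letter n} := [set a : letter n | a.2 && (a.1 <= i)].

Local Notation G x y := (nat_of_bool (ht (w y) < ht (w x))).

(** The chain splits into the consecutive blocks [pos_upto i], [above], [neg_upto], and [w]
    increases on each, so an inversion must join two different blocks. *)
Lemma ascending_inversions x y :
  ((ht x < ht y) && (ht (w y) < ht (w x)) : nat) =
  (x \in pos_upto i) * (y \notin pos_upto i) * G x y +
  (x \in above) * (y \in neg_upto) * G x y.
Proof.
have wf := weylP _ ww.
have blk : forall x y, ht x < ht y ->
   [|| (x \in pos_upto i) && (y \in pos_upto i), (x \in above) && (y \in above)
     | (x \in neg_upto) && (y \in neg_upto)] -> ht (w x) < ht (w y).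
  move=> {x y} [k [|]] [l [|]]; rewrite !inE /= ?andbF ?orbF ?orFb => xy.
  - rewrite -![(_, true)]/(flip (pos _)) !wf !ht_flip2.
    have lk : l < k by move: xy; rewrite /ht /=; have := ltn_ord k; have := ltn_ord l; lia.
    case/orP => /andP[h1 h2]; first exact: ascending_suffix.
    exact: ascending_prefix.
  - by move: xy; rewrite /ht /=; have := ltn_ord k; have := ltn_ord l; lia.
  (* The middle block crosses from positive to negative letters; there [w] preserves signs. *)
  - move=> /andP[ik il]; rewrite -[(_, true)]/(flip (pos _)) wf.
    have := ascending_suffix_pos ik; have := ascending_suffix_pos il.
    rewrite -[(k, false)]/(pos k) /ht /= => -> ->; have := ltn_ord (w (pos k)).1.
    have := ltn_ord (w (pos l)).1 => /=; lia.
  - have kl : k < l by move: xy; rewrite /ht /=.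
    case/orP => /andP[h1 h2]; first exact: ascending_prefix.
    exact: ascending_suffix.
have := blk x y; move: (ht (w x)) (ht (w y)) => hx hy {blk}.
case: x y => [k [|]] [l [|]]; rewrite !inE /= /ht /=.
all: have := ltn_ord k; have := ltn_ord l => ll lk.
all: case: (ssrnat.leqP k i) => ki; case: (ssrnat.leqP l i) => li //=.
all: rewrite ?mul0n ?mul1n ?addn0 ?orbF.
all: case: ssrnat.ltnP => xy //=; rewrite ?add0n.
all: try lia.
all: by move=> /(_ isT isT); case: ssrnat.ltngtP.
Qed.

Lemma neg_uptoE x : (x \in neg_upto) = (flip x \in pos_upto i).
Proof. by rewrite !inE negbK. Qed.

Lemma aboveE x : (x \in above) = (x \notin pos_upto i) && (x \notin neg_upto).
Proof. by case: x => [k [|]]; rewrite !inE /= ?andbT ltnNge. Qed.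

(** Let [U] count the inversions between the first two blocks and [X] those between the outer ones.
    Flipping gives [U] again for the last two, so [chain_inv w = 2U + X], while the ranks of the
    values on the first block sum to [U + X] plus a term depending on [i] only. *)
Lemma chain_inv_ascending :
  chain_inv w + \sum_(x in pos_upto i) \sum_(y in pos_upto i) (ht (w (flip y)) < ht (w x))
    + (\sum_(x in pos_upto i) \sum_(y in pos_upto i) (ht y < ht x)).*2
  = (\sum_(x in pos_upto i) ht (w x)).*2.
Proof.
have wf := weylP _ ww; set P := pos_upto i.
pose U := \sum_(x in P) \sum_(y in above) G x y.
pose X := \sum_(x in P) \sum_(y in neg_upto) G x y.
have disj y : y \in neg_upto -> y \notin P by rewrite !inE => /andP[->].
have cE : chain_inv w = U + X + U.
  rewrite /chain_inv; under eq_bigr => p _ do rewrite ascending_inversions.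
  rewrite -(pair_bigA _ (fun x y => (x \in P) * (y \notin P) * G x y +
     (x \in above) * (y \in neg_upto) * G x y)) /=.
  under eq_bigr => x _ do rewrite big_split /=.
  rewrite big_split /=; congr (_ + _).
    rewrite /U /X -big_split [RHS]big_mkcond /=; apply: eq_bigr => x _.
    case: ifP => xP; last by rewrite big1 // => y _; rewrite mul0n.
    rewrite [X in X + _]big_mkcond [X in _ + X]big_mkcond -big_split; apply: eq_bigr => y _.
    rewrite mul1n aboveE; case: (boolP (y \in neg_upto)) => [/disj yP|] /=.
      by rewrite yP mul1n.
    by rewrite andbT; case: (y \in P) => /=; rewrite ?mul0n ?mul1n ?addn0.
  rewrite exchange_big /= (reindex_inj (inv_inj (@flipK n))) /= /U [RHS]big_mkcond.
  apply: eq_bigr => x _; rewrite neg_uptoE flipK -/P.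
  case: ifP => xP; last by rewrite big1 // => y _; rewrite muln0.
  rewrite (reindex_inj (inv_inj (@flipK n))) [RHS]big_mkcond /=.
  apply: eq_bigr => y _; rewrite !wf ht_flip2 muln1 !inE.
  by case: (_ < _); rewrite ?mul0n ?mul1n.
have XE : \sum_(x in P) \sum_(y in P) (ht (w (flip y)) < ht (w x)) = X.
  apply: eq_bigr => x _; rewrite [RHS](reindex_inj (inv_inj (@flipK n))).
  by apply: eq_bigl => y; rewrite neg_uptoE flipK.
(* Each rank counts the letters below, sorted here by the block of their preimage. *)
have SE : \sum_(x in P) ht (w x) =
    \sum_(x in P) \sum_(y in P) (ht y < ht x) + (U + X).
  rewrite -2!big_split; apply: eq_bigr => x xP.
  rewrite -[LHS]sum_ht_lt (reindex_inj (@perm_inj _ w)).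
  rewrite (bigID (fun y => y \in P)) /=; congr (_ + _).
    apply: eq_bigr => y yP.
    have mono a b : a \in P -> b \in P -> ht a < ht b -> ht (w a) < ht (w b).
      by case: a b => [k []] [l []]; rewrite !inE //= => _ li kl; apply: ascending_prefix.
    congr (nat_of_bool _); apply/idP/idP; last exact: mono.
    apply: contraTT; rewrite -!leqNgt leq_eqVlt => /orP[/eqP/ht_inj->//|].
    by move=> /(mono _ _ xP yP)/ltnW.
  rewrite (bigID (fun y => y \in neg_upto)) /= addnC; congr (_ + _).
    by apply: eq_bigl => y; rewrite aboveE.
  by apply: eq_bigl => y; apply: andb_idl; apply: disj.
rewrite XE cE SE -!addnn.
by move: (bigop _ _ _) (U) (X); clear; lia.
Qed.

(** Values beyond [i] are positive. The sum consists of the diagonal terms left out of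
    [neg_pairs]. *)
Lemma negs_ascending : negs w = \sum_(x in pos_upto i) (ht (w (flip x)) < ht (w x)).
Proof.
have wf := weylP _ ww; rewrite /negs.
have -> : \sum_(x in pos_upto i) (ht (w (flip x)) < ht (w x)) =
    \sum_(x : letter n) if x \in pos_upto i then nat_of_bool (w x).2 else 0.
  by rewrite big_mkcond; apply: eq_bigr => x _; rewrite wf ht_ltflip.
pose F s (e : bool) := if (s, e) \in pos_upto i then nat_of_bool (w (s, e)).2 else 0.
rewrite (eq_bigr (fun x => F x.1 x.2)); last by case.
rewrite -(pair_bigA _ F) /F /=.
apply: eq_bigr => s _; rewrite big_bool !inE /= add0n.
by case: (ssrnat.leqP s i) => // /ascending_suffix_pos->.
Qed.

(** The cross term of [chain_inv_ascending] splits into its diagonal, [negs w], and its off-diagonal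
    part, [neg_pairs]. *)
Lemma dinv_ascending :
  dinv w + neg_pairs (w @: pos_upto i)
    + (\sum_(x in pos_upto i) \sum_(y in pos_upto i) (ht y < ht x)).*2
  = (sum_ht (w @: pos_upto i)).*2.
Proof.
have wf := weylP _ ww.
have inj A : {in A &, injective w} by move=> x y _ _ /perm_inj.
rewrite /sum_ht big_imset //= -chain_inv_ascending; congr (_ + _).
rewrite /dinv negs_ascending -addnA; congr (_ + _).
rewrite /neg_pairs big_imset //= -big_split; apply: eq_bigr => x xP /=.
rewrite [RHS](bigD1 x) //=; congr (_ + _).
rewrite big_mkcondr big_imset //= -big_mkcondr.
apply: eq_big => y; first by rewrite (inj_eq perm_inj).
by rewrite wf.
Qed.

End Ascending.
End LetterSets.

(** * Lengths and minimal coset representatives *)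

Section Cosets.
Variables (R : realType) (n : nat).
Implicit Types (w u v x : {perm letter n}) (s t i j k : 'I_n) (J : {set 'I_n}).

Lemma refl_simple j : refl (simple_root R j) = rperm j (next_letter j).
Proof. by rewrite simple_rootE refl_root_of // next_letter_index. Qed.

Lemma prod_refl (r : seq 'I_n) : (\prod_(j <- r) refl (simple_root R j))%g = word r.
Proof. by apply: eq_bigr => j _; apply: refl_simple. Qed.

(** A word of length [k] has [dinv] at most [2k]. The word from [reduced_word] attains this, and
    [size_reduced_word] places its length inside the range searched by [len]. *)
Lemma dinv_len w : w \in weyl n -> dinv w = (len R w).*2.
Proof.
move=> ww; have [r wr dr] := reduced_word ww.
have rlt : (size r < #|weyl n|)%N by apply: size_reduced_word; rewrite -wr.
have isr : is_word_of_length R w (size r).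
  by apply/existsP; exists (in_tuple r); rewrite prod_refl -wr.
have le (k : nat) : is_word_of_length R w k -> (size r <= k)%N.
  move=> /existsP[q /eqP wq]; have := dinv_word q [::].
  rewrite cats0 /word big_nil dinv1 -/(word q) -prod_refl -wq dr size_tuple.
  by lia.
suff <- : size r = len R w by [].
apply/eqP; rewrite eqn_leq; apply/andP; split.
  have h : has (is_word_of_length R w) (iota 0 #|weyl n|).
    by apply/hasP; exists (size r); rewrite ?mem_iota.
  apply: le; have := nth_find 0%N h; rewrite nth_iota ?add0n //.
  by rewrite -[X in (_ < X)%N](size_iota 0) -has_find.
rewrite leqNgt; apply/negP => lt; have := before_find 0%N lt.
by rewrite nth_iota // add0n isr.
Qed.

Lemma next_letter_upto i j a : j != i ->
  (rperm j (next_letter j) a \in pos_upto i) = (a \in pos_upto i).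
Proof.
move=> ji; have nij : (j : nat) <> i by move=> /val_inj E; rewrite E eqxx in ji.
case: (eqVneq j.+1 n) => [jn|jn].
  have ij : (j <= i)%N = false by have := ltn_ord i; lia.
  rewrite rpermE ?next_letter_neq // next_letter_last //.
  by do !case: eqP => [->|_]; rewrite !inE /= ?ij ?andbF.
have j1 : (j.+1 < n)%N by have := ltn_ord j; lia.
pose t : 'I_n := Ordinal j1; have jt : (t <= i)%N = (j <= i)%N by rewrite /t /=; lia.
rewrite rpermE ?next_letter_neq // (@next_letter_pos _ j t) //.
by do !case: eqP => [->|_]; rewrite !inE /= -?[(j < i)%N]/(t <= i)%N ?jt.
Qed.

Lemma weyl_of_upto i x : x \in weyl_of R [set~ i] ->
  x \in weyl n /\ forall a, (x a \in pos_upto i) = (a \in pos_upto i).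
Proof.
move=> /gen_prodgP[m [c cJ ->]].
apply: (big_ind (fun y => y \in weyl n /\
  forall a, (y a \in pos_upto i) = (a \in pos_upto i))).
- by split=> [|a]; rewrite ?group1 ?perm1.
- by move=> y z [yw yP] [zw zP]; split=> [|a]; rewrite ?groupM // permM zP yP.
move=> k _; have /imsetP[j] := cJ k; rewrite in_setC1 => ji ->.
rewrite refl_simple; have jw := rperm_weyl (next_letter_neq j).
exact: conj jw (fun a => next_letter_upto a ji).
Qed.

(** Elements of [W_J] preserve the first block before [u] acts, so its image is an invariant of the
    coset. *)
Lemma coset_image i u v : u \in weyl n -> v \in weyl_coset R [set~ i] u ->
  v \in weyl n /\ v @: pos_upto i = u @: pos_upto i.
Proof.
move=> uw /imsetP[x /weyl_of_upto[xw xP] ->]; rewrite /wmul; split; first exact: groupM.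
apply/setP => b; apply/imsetP/imsetP => [[a aP ->]|[a aP ->]].
  by exists (x a); rewrite ?xP // permM.
by exists (x^-1 a)%g; rewrite ?permM ?permKV // -xP permKV.
Qed.

Lemma coset_refl J u : u \in weyl_coset R J u.
Proof. by apply/imsetP; exists 1%g; rewrite ?group1 // /wmul mul1g. Qed.

Lemma coset_step J u v j : j \in J -> v \in weyl_coset R J u ->
  wmul v (refl (simple_root R j)) \in weyl_coset R J u.
Proof.
move=> jJ /imsetP[x xJ ->]; apply/imsetP.
exists (refl (simple_root R j) * x)%g; last by rewrite /wmul mulgA.
by apply: groupM => //; apply/mem_gen/imset_f.
Qed.

Lemma minimal_ascending i v : v \in weyl n ->
    (forall j, j != i -> len R v <= len R (wmul v (refl (simple_root R j))))%N ->
  ascending_off i v.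
Proof.
move=> vw vmin j ji; have := vmin j ji; have := dinv_rperm j vw.
have rv : (rperm j (next_letter j) * v)%g \in weyl n.
  by rewrite groupM // rperm_weyl // next_letter_neq.
rewrite /wmul refl_simple (dinv_len rv) (dinv_len vw).
have : ht (v (pos j)) != ht (v (next_letter j)).
  by rewrite (inj_eq (@ht_inj n)) (inj_eq perm_inj) eq_sym next_letter_neq.
move: (ht _) (ht _) (len R _) (len R v) => a b l m; case: (ssrnat.ltngtP a b) => //=.
by clear; lia.
Qed.

Lemma min_reps_ascending i w : w \in min_reps R [set~ i] ->
  w \in weyl n /\ ascending_off i w.
Proof.
rewrite inE => /andP[ww /forall_inP wmin]; split=> //; apply: minimal_ascending => // j ji.
by apply: wmin; apply: coset_step; rewrite ?coset_refl // !inE.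
Qed.

Lemma min_rep_ascending i u (v := min_rep R [set~ i] u) : u \in weyl n ->
  [/\ v \in weyl n, ascending_off i v & v @: pos_upto i = u @: pos_upto i].
Proof.
move=> uw; rewrite /v /min_rep; case: arg_minnP => [|v' v'u v'min]; first exact: coset_refl.
have [v'w v'E] := coset_image uw v'u; split=> //.
apply: minimal_ascending => // j ji; apply: v'min; apply: coset_step => //.
by rewrite !inE.
Qed.

Lemma QB_pairingE i (g : 'rV[R]_n) :
  2 * QB_pairing [set~ i] g = (n.*2 - i)%N%:R * psum i (coroot g).
Proof.
rewrite /QB_pairing rho_diff dotZr mulrA [2 * _]mulrC divfK ?pnatr_eq0 //.
congr (_ * _); rewrite dotE /psum [RHS]big_mkcond; apply: eq_bigr => k _.
have epsE l : eps R l 0 k = (k == l)%:R by rewrite mxE eqxx.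
rewrite summxE; case: ifP => ki.
  rewrite (bigD1 k) //= epsE eqxx big1 ?addr0 ?mulr1 // => l /andP[_ lk].
  by rewrite epsE eq_sym (negPf lk).
rewrite big1 ?mulr0 // => l li; rewrite epsE; case: eqP => // kl.
by rewrite kl li in ki.
Qed.

End Cosets.

(** * How far the length can drop *)

Section Drop.
Variables (R : realType) (n : nat) (i : 'I_n).
Implicit Types (a b c p : letter n) (s t j k : 'I_n).
Local Notation P := (pos_upto i).

(** The block consists of the letters ranked below [next_letter i]. *)
Lemma card_pos_upto : #|P| = i.+1.
Proof.
rewrite -ht_next -sum_ht_lt -sum1_card [LHS]big_mkcond; apply: eq_bigr => -[k b] _.
rewrite inE ht_next ltnS; case: b => /=; last by rewrite /ht /=; case: (k <= i)%N.
have ik : (n.*2.-1 - k <= i)%N = false by have := ltn_ord k; have := ltn_ord i; lia.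
by rewrite /ht /= ik.
Qed.

Lemma pos_upto_flip b : b \in P -> flip b \notin P.
Proof. by case: b => k []; rewrite !inE. Qed.

Variables (w v : {perm letter n}).
Hypotheses (ww : w \in weyl n) (vw : v \in weyl n).
Hypotheses (wup : ascending_off i w) (vup : ascending_off i v).

(** With [B] the shared values, the drop is [free_below B (w p) - free_below B (w c)], and the
    stated amount is its maximum. *)
Lemma one_letter_drop p c s : s = 0%N :> nat -> p \in P -> c \notin P ->
    flip c \notin P :\ p -> v @: P = w @: (c |: P :\ p) ->
  (len R w = len R v + (n.*2.-1 - i) <-> w p = bar s /\ w c = pos s)%N.
Proof.
have wf := weylP _ ww.
move=> s0 pP cP fcP vP; set B := w @: (P :\ p).
have wB b : (w b \in B) = (b \in P :\ p) by rewrite mem_imset //; apply: perm_inj.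
have cB : #|B| = i.
  rewrite card_imset; last exact: perm_inj.
  by have := cardsD1 p P; rewrite pP card_pos_upto => -[].
have pB : w p \notin B by rewrite wB !inE eqxx.
have cnB : w c \notin B by rewrite wB inE (negPf cP) andbF.
have fpB : flip (w p) \notin B by rewrite -wf wB inE (negPf (pos_upto_flip pP)) andbF.
have BB b : b \in B -> flip b \notin B.
  move=> /imsetP[d]; rewrite inE => /andP[_ dP] ->.
  by rewrite -wf wB inE (negPf (pos_upto_flip dP)) andbF.
have len_eq : (len R w + free_below B (w c) = len R v + free_below B (w p))%N.
  have := dinv_ascending ww wup; have := dinv_ascending vw vup.
  rewrite (dinv_len R ww) (dinv_len R vw) vP imsetU1 -/B -[in w @: P](setD1K pP) imsetU1 -/B.
  have := exchange_letter pB cnB.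
  move: (sum_ht _) (sum_ht _) (neg_pairs _) (neg_pairs _) (bigop _ _ _).
  move: (free_below _ _) (free_below _ _) (len R w) (len R v).
  by clear; lia.
split=> [E|[wp wc]].
  apply: (free_below_extreme s0 BB pB cnB fpB); rewrite cB.
  by move: len_eq E; move: (len R w) (len R v) (_ - _)%N; clear; lia.
(* [pos s] heads the chain and [bar s] ends it: nothing lies below the former, every other letter
   below the latter. *)
have g0 : free_below B (pos s) = 0%N.
  by rewrite /free_below big1 // => d _; rewrite [ht (pos s)]/ht /= s0.
have g1 : free_below B (bar s) = (n.*2.-1 - i)%N.
  rewrite -cB -(@card_free _ B (bar s)); last by rewrite -wp.
  rewrite free_belowE; apply: eq_card => d; rewrite !inE; congr (_ && _).
  have hb : ht (bar s) = n.*2.-1 by rewrite /ht /= s0 subn0.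
  by rewrite hb -(inj_eq (@ht_inj n)) hb ltn_neqAle; have := ht_lt d; case: eqP => //=; lia.
by move: len_eq; rewrite wp wc g0 g1 addn0.
Qed.

(** An intermediate set separates two exchanges, [w (pos s)] for [w (bar s)], then [w (pos t)] for
    [w (bar t)]; [free_below_le] bounds each drop. *)
Lemma two_letter_drop s t : (s < t)%N -> (t <= i)%N ->
    v @: P = w @: (bar t |: (bar s |: P :\ pos s :\ pos t)) ->
  (len R w <= len R v + (n.*2.-1 - i).*2)%N.
Proof.
have wf := weylP _ ww.
move=> st ti vP; set B1 := w @: (P :\ pos s); set B2 := w @: (bar s |: P :\ pos s :\ pos t).
have wB (A : {set letter n}) b : (w b \in w @: A) = (b \in A).
  by rewrite mem_imset //; apply: perm_inj.
have sP : pos s \in P by rewrite inE /=; apply: leq_trans (ltnW st) ti.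
have tP : pos t \in P :\ pos s.
  rewrite !inE /= ti andbT xpair_eqE andbT; apply/eqP => E.
  by move: st; rewrite E ltnn.
have bP k : bar k \notin P by rewrite inE.
have pb k l : pos k != bar l by rewrite xpair_eqE andbF.
have bp k l : bar k != pos l by rewrite xpair_eqE andbF.
have ne : bar t != bar s by rewrite xpair_eqE andbT; apply/eqP => E; move: st; rewrite E ltnn.
have c1 : #|B1| = i.
  rewrite card_imset; last exact: perm_inj.
  by have := cardsD1 (pos s) P; rewrite sP card_pos_upto => -[].
have c2 : #|B2| = i.
  rewrite card_imset; last exact: perm_inj.
  rewrite cardsU1 !inE /= !andbF /=; have := cardsD1 (pos t) (P :\ pos s).
  by rewrite tP -c1 card_imset //; apply: perm_inj.
have s1 : w (pos s) \notin B1 by rewrite wB !inE eqxx.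
have s2 : w (bar s) \notin B1 by rewrite wB !inE andbF.
have t1 : w (pos t) \notin B2 by rewrite wB !inE eqxx (negPf (pb _ _)).
have t2 : w (bar t) \notin B2 by rewrite wB !inE (negPf ne) /= !andbF.
have E12 : w (bar s) |: B1 = w (pos t) |: B2.
  by rewrite -!imsetU1; congr (_ @: _); rewrite setUCA setD1K.
have := dinv_ascending ww wup; have := dinv_ascending vw vup.
rewrite (dinv_len R ww) (dinv_len R vw) vP imsetU1 -/B2 -[in w @: P](setD1K sP) imsetU1 -/B1.
have := exchange_letter s1 s2; have := exchange_letter t1 t2; rewrite E12.
have : (free_below B1 (w (pos s)) <= n.*2.-1 - i)%N.
  by rewrite -c1 free_below_le // -wf wB !inE andbF.
have : (free_below B2 (w (pos t)) <= n.*2.-1 - i)%N by rewrite -c2 free_below_le // -wf.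
move: (sum_ht _) (sum_ht _) (sum_ht _) (neg_pairs _) (neg_pairs _) (neg_pairs _) (bigop _ _ _).
move: (free_below _ _) (free_below _ _) (free_below _ _) (free_below _ _) (len R w) (len R v).
by move: (_ - _)%N; clear; lia.
Qed.

End Drop.

(** * Reflections on the first block, and quantum edges as equations *)

Section Edges.
Variables (R : realType) (n : nat).
Implicit Types (a b c : letter n) (s t i j k : 'I_n).

Lemma rperm_imset s c (A : {set letter n}) b : c != pos s ->
  (b \in rperm s c @: A) = (rperm s c b \in A).
Proof.
move=> cs; have rK d : rperm s c (rperm s c d) = d by rewrite -permM rpermK // perm1.
apply/imsetP/idP => [[d dA ->]|bA]; first by rewrite rK.
by exists (rperm s c b); rewrite ?rK.
Qed.

Lemma rperm_upto i s c : root_index s c -> (s <= i)%N -> (c == bar s) || (i < c.1)%N ->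
  rperm s c @: pos_upto i = c |: pos_upto i :\ pos s.
Proof.
move=> sc si ci; have cs := root_index_neq sc.
have bP k : (bar k \in pos_upto i) = false by rewrite inE.
have cP : (c \in pos_upto i) = false.
  by case/orP: ci => [/eqP->//|ci]; rewrite inE [(_ <= i)%N]leqNgt ci andbF.
have fP : c != bar s -> (flip c \in pos_upto i) = false.
  by move=> /negPf cb; move: ci; rewrite cb inE /= => ci; rewrite [(_ <= i)%N]leqNgt ci andbF.
apply/setP => b; rewrite rperm_imset // rpermE // in_setU1 in_setD1.
case: (eqVneq b (pos s)) => [->|bs]; first by rewrite cP eq_sym (negPf cs).
case: (eqVneq b c) => [->|bc]; first by rewrite inE /= si.
case: (eqVneq b (bar s)) => [E|_] /=.
  by rewrite E bP fP // eq_sym -E.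
case: (eqVneq b (flip c)) => [E|_] //; rewrite E bP fP //.
by apply: contraNneq bs => cb; rewrite E cb.
Qed.

(** The reflection in [eps_s + eps_t] sends [pos s] to [bar t] and [pos t] to [bar s]: two letters
    leave the block. *)
Lemma rperm_upto2 i s t : (s < t)%N -> (t <= i)%N ->
  rperm s (bar t) @: pos_upto i = bar t |: (bar s |: pos_upto i :\ pos s :\ pos t).
Proof.
move=> st ti; have ts : bar t != pos s by rewrite xpair_eqE andbF.
have bP k : (bar k \in pos_upto i) = false by rewrite inE.
have sP : pos s \in pos_upto i by rewrite inE /=; apply: leq_trans (ltnW st) ti.
have tP : pos t \in pos_upto i by rewrite inE /=.
have pb k l : (pos k == bar l) = false by rewrite xpair_eqE andbF.
apply/setP => b; rewrite rperm_imset // rpermE // !in_setU1 !in_setD1 -[flip (bar t)]/(pos t).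
case: (eqVneq b (pos s)) => [->|_]; first by rewrite bP !pb /= andbF.
case: (eqVneq b (bar t)) => [->|_] //.
case: (eqVneq b (bar s)) => [->|_] //.
by case: (eqVneq b (pos t)) => [->|_].
Qed.

Lemma natr_diff (a b N : nat) : (a%:R - b%:R = 1 - N%:R :> R) <-> (b.+1 = a + N)%N.
Proof.
split=> [E|E].
  by apply/eqP; rewrite -(eqr_nat R) -natr1 natrD; apply/eqP; lra.
by have : (b.+1%:R = (a + N)%:R :> R) by [rewrite E]; rewrite -natr1 natrD; lra.
Qed.

Lemma quantum_edgeE i w s c (g := root_of R s c)
    (v := min_rep R [set~ i] (wmul w (refl g))) :
    w \in min_reps R [set~ i] -> root_index s c ->
  quantum_edge [set~ i] w g v <->
  psum i g != 0 /\
  (len R v)%:R - (len R w)%:R = 1 - (n.*2 - i)%N%:R * psum i (coroot g).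
Proof.
move=> wJ sc; have gP : g \in pos_roots R n by apply/pos_rootsP; exists s, c.
have gJ : (g \in pos_roots_of R [set~ i]) = (psum i g == 0).
  by rewrite mem_filter gP andbT in_root_lattice_root_of.
rewrite -QB_pairingE; split=> [[[_ + _ _] lenE]|[g0 lenE]].
  by rewrite gJ => /andP[_ g0].
split=> //; split=> //; first by rewrite gP gJ.
(* The quantum equation is the edge condition with [chi = 1]. *)
by exists true; rewrite mulr1.
Qed.

End Edges.

(** * Characterization of quantum edges *)

Section QuantumEdges.
Variables (R : realType) (n : nat).
Implicit Types (a b c d : letter n) (s t i j k l : 'I_n).

(** Either one or two letters leave the first block. Roots with [i < s], and [eps_s - eps_t] with
    [t <= i], have [psum i] zero. *)
Lemma psum_root_of_cases i s c : root_index s c -> psum i (root_of R s c) != 0 ->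
  [/\ (s <= i)%N, (c == bar s) || (i < c.1)%N & psum i (coroot (root_of R s c)) = 1] \/
  exists t, [/\ c = bar t, (s < t <= i)%N & psum i (coroot (root_of R s c)) = 2].
Proof.
move=> sc; rewrite coroot_root_of // psum_root_of; move: sc; rewrite /root_index.
case: (eqVneq c (bar s)) => [->|cb]; rewrite ?orbT ?orbF /= => sc g0.
  have si : (s <= i)%N.
    by apply: contraNT g0; rewrite -[(s <= i)%N]/(leq s i) => /negPf->; rewrite mulr0n subr0.
  by left; split; rewrite // -wt_pos psum_wt si.
rewrite psum_root_of; have [ci|ic] := leqP c.1 i; last first.
  have si : (s <= i)%N.
    by apply: contraNT g0 => /negPf->; rewrite leqNgt ic subr0.
  by left; split=> //; rewrite si mulr0n subr0.
right; exists c.1; have si : (s <= i)%N by apply: leq_trans (ltnW sc) ci.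
move: g0; rewrite si ci; case: (c) sc => [t []] /= st; last by rewrite expr0 subrr eqxx.
by rewrite expr1 mulr1n opprK => _; split; rewrite ?st.
Qed.

Variables (i : 'I_n) (w : {perm letter n}) (s : 'I_n) (c : letter n) (o : 'I_n).
Hypotheses (wJ : w \in min_reps R [set~ i]) (sc : root_index s c) (o0 : o = 0%N :> nat).
Local Notation g := (root_of R s c).
Let v := min_rep R [set~ i] (wmul w (refl g)).
Local Notation P := (pos_upto i).

Let ww : w \in weyl n. Proof. by have [] := min_reps_ascending wJ. Qed.
Let wup : ascending_off i w. Proof. by have [] := min_reps_ascending wJ. Qed.

Let v_spec : [/\ v \in weyl n, ascending_off i v & v @: P = w @: (rperm s c @: P)].
Proof.
have [|vw vup vE] := @min_rep_ascending R n i (wmul w (refl g)).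
  by rewrite groupM // refl_root_of // rperm_weyl // root_index_neq.
split=> //; rewrite vE refl_root_of // -imset_comp.
by apply: eq_imset => a; rewrite permM.
Qed.

(** If one letter is exchanged, the required drop is the maximal one and [one_letter_drop] applies;
    two exchanges cannot reach theirs. The letters [pos o] and [bar o] are the ends of the chain. *)
Lemma quantum_edge_last_letter : quantum_edge [set~ i] w g v <->
  [/\ s = i, c = bar i & w (pos i) = bar o].
Proof.
have [vw vup vP] := v_spec; have wf := weylP _ ww; have li := ltn_ord i.
have oi : flip (bar o) = pos o by [].
rewrite quantum_edgeE // -/v; split; last first.
  case=> si cE wi; have sc' := sc; rewrite si cE in sc' *.
  have pi1 : psum i (coroot (root_of R i (bar i))) = 1.
    by rewrite coroot_root_of // eqxx -wt_pos psum_wt leqnn.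
  split; first by rewrite psum_root_of leqnn /= expr1 mulr1n opprK -[1 + 1]/(2%:R) pnatr_eq0.
  rewrite pi1 mulr1 natr_diff.
  have wbi : w (bar i) = pos o by rewrite -[bar i]/(flip (pos i)) wf wi.
  rewrite si cE rperm_upto ?eqxx // in vP.
  have -> : len R w = (len R v + (n.*2.-1 - i))%N.
    apply/(one_letter_drop R ww vw wup vup o0 _ _ _ vP) => //; rewrite ?inE ?eqxx //=.
  by move: (len R v) => m; clear -li; lia.
move=> [g0 lenE]; have [[si ci p1]|[t [cE /andP[st ti] p2]]] := psum_root_of_cases sc g0.
  rewrite p1 mulr1 natr_diff in lenE; rewrite rperm_upto // in vP.
  have cP : c \notin P.
    by case/orP: ci => [/eqP->|ci]; rewrite inE // [(_ <= i)%N]leqNgt ci andbF.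
  have fcP : flip c \notin P :\ pos s.
    by case/orP: ci => [/eqP->|ci]; rewrite !inE ?eqxx // [(_ <= i)%N]leqNgt ci !andbF.
  have sP : pos s \in P by rewrite inE.
  have [wps wc] : w (pos s) = bar o /\ w c = pos o.
    apply/(one_letter_drop R ww vw wup vup o0 sP cP fcP vP).
    by move: lenE; move: (len R v) (len R w) => m m'; clear -li; lia.
  have cE : c = bar s.
    by apply: (@perm_inj _ w); rewrite wc -oi -wps -wf.
  (* [bar o] is the last letter of the chain, and [w] increases up to index [i]. *)
  have si' : s = i.
    apply: val_inj; apply/eqP; rewrite eqn_leq si leqNgt; apply/negP => lt.
    have := ascending_prefix wup lt (leqnn i); rewrite wps.
    by have := ht_lt (w (pos i)); rewrite [ht (bar o)]/ht /= o0; lia.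
  by split; rewrite -?si'.
(* The required drop is [2 (2n - i) - 1], above the bound [2 (2n - 1 - i)]. *)
rewrite p2 -natrM natr_diff in lenE.
rewrite cE rperm_upto2 // in vP.
have := two_letter_drop R ww vw wup vup st ti vP.
by move: lenE; move: (len R v) (len R w) => m m'; clear -li; lia.
Qed.

(** On the first block [v] takes the values of [w] with [bar o] replaced by [pos o], and both
    increase: sorting puts [pos o] in front and shifts the others. *)
Lemma last_letter_shift : s = i -> c = bar i -> w (pos i) = bar o ->
  v (pos o) = pos o /\
  (forall u t : 'I_n, u = t.+1 :> nat -> (u <= i)%N -> v (pos u) = w (pos t)).
Proof.
have [vw vup vP] := v_spec; have wf := weylP _ ww.
move=> si cE wi; rewrite si cE in vP.
have wbi : w (bar i) = pos o by rewrite -[bar i]/(flip (pos i)) wf wi.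
have ipos : root_index i (bar i) by rewrite /root_index eqxx orbT.
rewrite rperm_upto ?eqxx // imsetU1 wbi in vP.
have mP k : (k <= i)%N -> pos k \in P by rewrite inE.
(* At index 0 this returns 0 again; [h] treats that index apart. *)
pose prd k : 'I_n := Ordinal (leq_ltn_trans (leq_pred k) (ltn_ord k)).
pose h k := if k == 0%N :> nat then 0%N else ht (w (pos (prd k))).
have vE k : (k < i.+1)%N -> ht (v (pos k)) = h k.
  move: k; apply: (@increasing_same_image n i.+1 (fun k => ht (v (pos k))) h)
    => [j k jk ki|j k jk ki|k ki|k ki].
  - exact: ascending_prefix vup _ _ jk ki.
  - rewrite /h; have -> : (k == 0 :> nat) = false by apply/negbTE; lia.
    case: eqP => [j0|j0].
      (* Rank 0 belongs to [w (bar i)], so [w] gives it to no positive letter. *)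
      rewrite lt0n; apply/eqP => hk; have : w (pos (prd k)) = w (bar i).
        by rewrite wbi; apply: ht_inj; rewrite hk /ht /= o0.
      by move/perm_inj.
    by apply: ascending_prefix wup _ _ _ _ => /=; lia.
  - have : v (pos k) \in v @: P by apply/imset_f/mP.
    rewrite vP in_setU1 => /orP[/eqP->|/imsetP[[l e]]].
      by exists o; rewrite ?o0 // /h o0 eqxx /ht /= o0.
    rewrite !inE /= => /and3P[li e0 le ->].
    have {}e0 : e = false by case: (e) e0.
    have l1 : (l < i)%N.
      rewrite ltn_neqAle le andbT; apply: contraNneq li => /val_inj ->.
      by rewrite e0.
    exists (Ordinal (leq_ltn_trans l1 (ltn_ord i))) => //=.
    by rewrite /h /= e0; congr (ht (w (_, _))); apply: val_inj.
  - have wv d : w d \in v @: P -> exists2 l : 'I_n, (l < i.+1)%N & ht (w d) = ht (v (pos l)).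
      move=> /imsetP[[l []]]; rewrite !inE //= => li ->.
      by exists l.
    rewrite /h; case: eqP => [k0|k0].
      have [|l li lE] := wv (bar i); first by rewrite wbi vP setU11.
      by exists l => //; rewrite -lE wbi /ht /= o0.
    apply: wv; rewrite vP in_setU1; apply/orP; right; apply: imset_f.
    rewrite !inE /= xpair_eqE andbT; apply/andP; split; last by lia.
    by apply/eqP => /(congr1 val) /=; lia.
split; first by apply: ht_inj; rewrite vE /h o0 //= /ht /= o0.
move=> u t ut ui; apply: ht_inj; rewrite vE // /h ut /=.
by congr (ht (w (pos _))); apply: val_inj; rewrite /= ut.
Qed.

(** The conditions list the values of [v] on the first block as [w (bar i)] and [w (pos t)] with
    [t < i], so only [bar i] can enter the block under the reflection. *)
Lemma shift_last_letter : psum i g != 0 -> w (pos i) = bar o -> v (pos o) = pos o ->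
  (forall u t : 'I_n, u = t.+1 :> nat -> (u <= i)%N -> v (pos u) = w (pos t)) ->
  s = i /\ c = bar i.
Proof.
have [vw vup vP] := v_spec; have wf := weylP _ ww.
move=> g0 wi vo vu.
have wbi : w (bar i) = pos o by rewrite -[bar i]/(flip (pos i)) wf wi.
have key d : d \notin P -> d \in rperm s c @: P -> d = bar i.
  move=> dP dr; have : w d \in v @: P by rewrite vP; apply: imset_f.
  move=> /imsetP[[k []]]; rewrite !inE //= => ki wd.
  case: (eqVneq (k : nat) 0%N) => [k0|k0].
    have ko : k = o by apply: val_inj; rewrite /= k0 o0.
    by apply: (@perm_inj _ w); rewrite wd wbi ko -[(o, false)]/(pos o).
  pose t : 'I_n := Ordinal (leq_ltn_trans (leq_pred k) (ltn_ord k)).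
  have kt : k = t.+1 :> nat by rewrite /t /=; lia.
  move: wd; rewrite -[(k, false)]/(pos k) (vu k t kt ki) => /perm_inj dE.
  by move: dP; rewrite dE inE /=; lia.
have [[si ci _]|[t [cE /andP[st ti] _]]] := psum_root_of_cases sc g0.
  have cP : c \notin P.
    by case/orP: ci => [/eqP->|ci]; rewrite inE // [(_ <= i)%N]leqNgt ci andbF.
  have ce : c = bar i by apply: key; rewrite // rperm_upto // setU11.
  split=> //; move: ci; rewrite ce ltnn orbF => /eqP/(congr1 fst) /= ->.
  by [].
have bP k : bar k \notin P by rewrite inE.
(* With two letters exchanged [bar s] enters the block, forcing [s = i] against [s < t <= i]. *)
have := key (bar s) (bP s); rewrite cE rperm_upto2 // in_setU1 setU11 orbT => /(_ isT).
by move=> /(congr1 fst) /= E; move: st; rewrite E; lia.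
Qed.

End QuantumEdges.

Theorem proposition4p18 (R : realType) (n : nat) (hn : (2 <= n)%N) (i : 'I_n)
    (w : {perm letter n}) (g : 'rV[R]_n) :
  let one : 'I_n := Ordinal (ltnW hn) in
  let J : {set 'I_n} := [set~ i] in
  let v := min_rep R J (wmul w (refl g)) in
  w \in min_reps R J ->
  g \in pos_roots R n ->
  (quantum_edge J w g v <->
     (g \in pos_roots R n) && (g \notin pos_roots_of R J) /\
     [/\ coroot_coef i (coroot g) = 1,
         v (pos one) = pos one,
         (forall u t : 'I_n, u = t.+1 :> nat -> (u <= i)%N ->
            v (pos u) = w (pos t)) &
         w (pos i) = bar one])
  /\ (quantum_edge J w g v ->
        coroot g = eps R i /\
        eps R i = \sum_(j < n | (i <= j)%N) coroot (simple_root R j)).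
Proof.
move=> one J v wJ /[dup] gP /pos_rootsP[s [c [sc gE]]].
have o0 : one = 0%N :> nat by [].
have gJ : (g \in pos_roots R n) && (g \notin pos_roots_of R J) = (psum i g != 0).
  by rewrite gP mem_filter gP andbT gE in_root_lattice_root_of.
rewrite gJ /v gE (quantum_edge_last_letter wJ sc o0).
have cE : s = i -> c = bar i -> coroot (root_of R s c) = eps R i.
  by move=> si ci; rewrite coroot_root_of // ci si eqxx.
have pE : psum i (eps R i) = 1 by rewrite -wt_pos psum_wt leqnn.
split; last by move=> [si ci _]; split; [exact: cE | exact: eps_sum_simple_coroots].
split=> [[si ci wi]|[g0 [_ vo vu wi]]].
  have [vo vu] := last_letter_shift wJ sc o0 si ci wi.
  have [_ dE] := simple_coroots_dual R n.
  (* The coefficient of the simple coroot [i] is [psum i], which is 1 on [eps R i]. *)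
  split; last by split=> //; rewrite /coroot_coef cE // dE.
  rewrite si ci psum_root_of leqnn /= expr1 mulr1n opprK.
  by rewrite -[1 + 1]/(2%:R) pnatr_eq0.
by have [si ci] := shift_last_letter wJ sc o0 g0 wi vo vu; split.
Qed.
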